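(* Let $N$ be a semifinite factor, let $t_1,t_2,\ldots,t_n$ be elements of $N$ such that $\sum_{i=1}^n t_it_i^*\leq I$, and let $\Theta$ be the contractive, normal, completely positive map on $N$ defined by $\Theta(a)=\sum_{i=1}^n t_iat_i^*$. Then $$d(\Theta)=\dim_{\mathbb{C}}\operatorname{span}\{t_i: 1\leq i\leq n\}\in\{0,1,\ldots,n\},$$ where $\dim_{\mathbb{C}}$ is the dimension as a complex vector space and $d(\Theta)$ is the index of $\Theta$.
   Context: Index of a contractive normal completely positive map $\Theta$ on a semifinite factor $N$: represent $N$ (faithfully, normally, unitally) on a Hilbert space $H$ so that $N'$ is finite. $N\otimes_\Theta H$ is the Hausdorff completion of the algebraic tensor product of $N$ and $H$ for $\langle a_1\otimes h_1,a_2\otimes h_2\rangle=\langle h_1,\Theta(a_1^*a_2)h_2\rangle$; $N$ acts by $(a\otimes I)(b\otimes h)=ab\otimes h$, $N'$ acts by $(I\otimes c)(b\otimes h)=b\otimes ch$. The Arveson-Stinespring correspondence $\mathcal{E}_\Theta=\{X\in B(H,N\otimes_\Theta H): Xa=(a\otimes I)X,\ a\in N\}$ is a $W^*$-correspondence over $N'$ with $X\cdot c=Xc$, $\varphi(c)X=(I\otimes c)X$, $\langle X,Y\rangle=X^*Y$. The index is $d(\Theta)=\dim_l(\mathcal{E}_\Theta)$; it does not depend on the chosen representation with finite commutant. Left dimension: let $M$ be a finite factor with normalized trace $\tau$, $L^2(M)$ its GNS space with left and right multiplications $\lambda,\rho$. For a normal unital representation $\sigma$ of $M$ on $H$ choose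 an isometry $u:H\to L^2(M)\otimes K_0$ ($K_0$ a large enough Hilbert space) with $u\sigma(a)=(\lambda(a)\otimes I)u$; writing $uu^*=(\rho(p_{ij}))$, $\dim_M(H)=\sum_i\tau(p_{ii})\in[0,\infty]$. For a $W^*$-correspondence $\mathcal{E}$ over $M$ with left action $\varphi$, $\dim_l(\mathcal{E})$ is the dimension of $\mathcal{E}\otimes_\lambda L^2(M)$ as a left $M$-module via $a\mapsto\varphi(a)\otimes I$. *)

(* Defs.v *)
From HB Require Import structures.
From mathcomp Require Import all_boot all_order all_algebra complex.
From mathcomp Require Import all_classical all_reals all_analysis.

Set Implicit Arguments.
Unset Strict Implicit.
Unset Printing Implicit Defensive.

Import Order.TTheory GRing.Theory Num.Theory numFieldNormedType.Exports.
Local Open Scope classical_set_scope.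
Local Open Scope complex_scope.
Local Open Scope ring_scope.

(** * Hilbert spaces and bounded operators *)

(* [{dot _ for _}] is linear in its first argument; [dot] below swaps the
   arguments, so that [dot x y] is conjugate-linear in [x]. *)
Record hilbert (R : realType) := Hilbert {
  hcar :> completeNormedModType R[i] ;
  hform : {dot hcar for Num.conj} ;
  hnormE : forall x : hcar, `|x| ^+ 2 = hform x x }.

Definition dot (R : realType) (H : hilbert R) (x y : H) : R[i] := hform H y x.

Section Operators.
Context {R : realType}.
Implicit Types H K : hilbert R.

Definition bounded_op H K (T : H -> K) : Prop := linear T /\ continuous T.

(* The default 0 is not reached at a bounded [T], by Riesz. *)
Definition adj H K (T : H -> K) : K -> H :=
  xget (fun=> 0) [set S : K -> H |
    bounded_op S /\ forall x y, dot (T x) y = dot x (S y)].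

Definition selfadjoint H (a : H -> H) : Prop := bounded_op a /\ adj a = a.

Definition op_le H (a b : H -> H) : Prop :=
  forall x, dot x (a x) <= dot x (b x).

Definition op_lub H (D : set (H -> H)) (s : H -> H) : Prop :=
  [/\ selfadjoint s, (forall a, D a -> op_le a s) &
      forall b, selfadjoint b -> (forall a, D a -> op_le a b) -> op_le s b].

Definition projection H (p : H -> H) : Prop := selfadjoint p /\ p \o p = p.

(* The bounded operator determined on the dense range of [f] by
   [f x |-> g x], for [x] in [D]. *)
Definition bounded_ext (X : Type) H K (D : set X) (f : X -> H) (g : X -> K) :
    H -> K :=
  xget (fun=> 0) [set T : H -> K |
    bounded_op T /\ forall x, D x -> T (f x) = g x].

End Operators.

(** * Linear span and dimension *)

Section Span.
Context {R : realType} {V : lmodType R[i]}.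

Definition lin_span (S : set V) : set V :=
  [set x | exists m (c : 'I_m -> R[i]) (s : 'I_m -> V),
    (forall k, S (s k)) /\ x = \sum_k c k *: s k].

Definition lin_indep (d : nat) (b : 'I_d -> V) : Prop :=
  forall c : 'I_d -> R[i], \sum_k c k *: b k = 0 -> forall k, c k = 0.

(* The subspace [S] has dimension [d] (in particular, finite). *)
Definition has_dim (S : set V) (d : nat) : Prop :=
  exists b : 'I_d -> V, lin_indep b /\ lin_span (range b) = S.

End Span.

(** * Von Neumann algebras *)

Section VonNeumann.
Context {R : realType}.
Implicit Types H K : hilbert R.

Definition commutant H (S : set (H -> H)) : set (H -> H) :=
  [set b | bounded_op b /\ forall a, S a -> a \o b = b \o a].

Definition von_neumann H (N : set (H -> H)) : Prop :=
  [/\ (forall a, N a -> bounded_op a), (forall a, N a -> N (adj a)) &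
      commutant (commutant N) = N].

Definition vn_factor H (N : set (H -> H)) : Prop :=
  von_neumann N /\
  N `&` commutant N = [set a | exists c : R[i], a = (fun x => c *: x)].

(* Murray-von Neumann equivalence *)
Definition mv_equiv H (N : set (H -> H)) (p q : H -> H) : Prop :=
  exists v, [/\ N v, adj v \o v = p & v \o adj v = q].

Definition finite_projection H (N : set (H -> H)) (p : H -> H) : Prop :=
  [/\ N p, projection p &
      forall q, N q -> projection q -> mv_equiv N p q -> op_le q p -> q = p].

Definition finite_algebra H (N : set (H -> H)) : Prop :=
  finite_projection N idfun.

Definition semifinite H (N : set (H -> H)) : Prop :=
  forall z, N z -> commutant N z -> projection z -> z <> 0 ->
    exists p, [/\ finite_projection N p, p <> 0 & op_le p z].

(* On a finite factor there is exactly one such [tau], and it is automatically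
   faithful and normal. *)
Definition normalized_trace H (M : set (H -> H)) (tau : (H -> H) -> R[i]) :
    Prop :=
  [/\ (forall (c : R[i]) a b, M a -> M b -> tau (c *: a + b) = c * tau a + tau b),
      (forall a, M a -> op_le 0 a -> 0 <= tau a),
      (forall a b, M a -> M b -> tau (a \o b) = tau (b \o a)) &
      tau idfun = 1].

(* Compatibility with suprema of increasing nets of self-adjoint elements *)
Definition normal_map H K (N : set (H -> H)) (pi : (H -> H) -> (K -> K)) :
    Prop :=
  forall (D : set (H -> H)) s,
    D `<=` N -> (forall a, D a -> selfadjoint a) -> D !=set0 ->
    (forall a b, D a -> D b -> exists c, [/\ D c, op_le a c & op_le b c]) ->
    N s -> op_lub D s -> op_lub (pi @` D) (pi s).

(* Only the values of [pi] on [N] matter. The image of a von Neumann algebra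
   under a faithful normal unital representation is always a von Neumann
   algebra; the last clause records this. *)
Definition faithful_normal_rep H K (N : set (H -> H))
    (pi : (H -> H) -> (K -> K)) : Prop :=
  [/\ (forall (c : R[i]) a b, N a -> N b -> pi (c *: a + b) = c *: pi a + pi b),
      (forall a b, N a -> N b -> pi (a \o b) = pi a \o pi b),
      (forall a, N a -> pi (adj a) = adj (pi a)),
      pi idfun = idfun &
      [/\ (forall a b, N a -> N b -> pi a = pi b -> a = b),
          normal_map N pi &
          von_neumann (pi @` N)]].

End VonNeumann.

(** * Completed tensor products *)

Section Tensor.
Context {R : realType}.
Implicit Types (K W : hilbert R) (V : lmodType R[i]).

(* [K], with [(v, w) |-> iota v w], is the Hausdorff completion of the
   algebraic tensor product of [E] and [W] for the semi-inner product
   [<v1 (x) w1, v2 (x) w2> = form v1 w1 v2 w2]. *)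
Definition tensor_completion V W (E : set V) (form : V -> W -> V -> W -> R[i])
    K (iota : V -> W -> K) : Prop :=
  [/\ (forall (c : R[i]) v v' w, E v -> E v' ->
        iota (c *: v + v') w = c *: iota v w + iota v' w),
      (forall (c : R[i]) v w w', E v ->
        iota v (c *: w + w') = c *: iota v w + iota v w'),
      (forall v1 w1 v2 w2, E v1 -> E v2 ->
        dot (iota v1 w1) (iota v2 w2) = form v1 w1 v2 w2) &
      dense (lin_span [set k | exists v w, E v /\ k = iota v w])].

(* The operator [v (x) w |-> f v (x) g w] *)
Definition tensor_op V W (E : set V) K (iota : V -> W -> K)
    (f : V -> V) (g : W -> W) : K -> K :=
  bounded_ext (E `*` [set: W]) (fun x => iota x.1 x.2)
    (fun x => iota (f x.1) (g x.2)).

End Tensor.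

(** * Left dimension *)

Section LeftDimension.
Context {R : realType}.
Variables (H : hilbert R) (M : set (H -> H)) (tau : (H -> H) -> R[i]).

(* [L2] is the GNS space of [tau], [Lam] the canonical map of [M] into it. *)
Definition gns (L2 : hilbert R) (Lam : (H -> H) -> L2) : Prop :=
  [/\ (forall (c : R[i]) a b, M a -> M b -> Lam (c *: a + b) = c *: Lam a + Lam b),
      (forall a b, M a -> M b -> dot (Lam a) (Lam b) = tau (adj a \o b)) &
      dense (Lam @` M)].

Definition lmult (L2 : hilbert R) (Lam : (H -> H) -> L2) (a : H -> H) :
    L2 -> L2 := bounded_ext M Lam (fun b => Lam (a \o b)).

Definition rmult (L2 : hilbert R) (Lam : (H -> H) -> L2) (a : H -> H) :
    L2 -> L2 := bounded_ext M Lam (fun b => Lam (b \o a)).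

Definition orthonormal_basis (K : hilbert R) (I : choiceType) (e : I -> K) :
    Prop :=
  (forall j k, dot (e j) (e k) = (j == k)%:R) /\ dense (lin_span (range e)).

(* [d] is the dimension of the left [M]-module [G] with action [sigma]. The
   matrix of [u u^*] is taken in the orthonormal basis [e] of [K0], [T] is
   [L2 (x) K0], and [tau (p j j)] is a nonnegative real. *)
Definition is_module_dim (L2 : hilbert R) (Lam : (H -> H) -> L2)
    (G : hilbert R) (sigma : (H -> H) -> (G -> G)) (d : \bar R) : Prop :=
  exists (K0 : hilbert R) (I : choiceType) (e : I -> K0) (T : hilbert R)
      (iota : L2 -> K0 -> T) (u : G -> T) (p : I -> I -> (H -> H)),
    [/\ orthonormal_basis e,
        tensor_completion setT
          (fun x1 k1 x2 k2 => dot x1 x2 * dot k1 k2) iota,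
        [/\ bounded_op u, (forall x, `|u x| = `|x|) &
            forall a, M a ->
              u \o sigma a = tensor_op setT iota (lmult Lam a) idfun \o u],
        (forall j k, M (p j k) /\ forall x y,
          dot (iota x (e j)) (u (adj u (iota y (e k))))
            = dot x (rmult Lam (p j k) y)) &
        d = \esum_(j in [set: I]) (complex.Re (tau (p j j)))%:E].

(* The data of a correspondence over [M]: a subspace of an ambient vector
   space, with two actions of [M] and an [M]-valued inner product. *)
Record correspondence := Correspondence {
  cambient : lmodType R[i] ;
  celem : set cambient ;
  cright : cambient -> (H -> H) -> cambient ;
  cleft : (H -> H) -> cambient -> cambient ;
  cinner : cambient -> cambient -> (H -> H) }.

(* [P] is the tensor product of [E] and [L2] over [lambda]. *)
Definition is_left_dim (E : correspondence) (d : \bar R) : Prop :=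
  exists (L2 : hilbert R) (Lam : (H -> H) -> L2) (P : hilbert R)
      (iota : cambient E -> L2 -> P),
    [/\ gns Lam,
        tensor_completion (@celem E)
          (fun X x Y y => dot x (lmult Lam (cinner X Y) y)) iota &
        is_module_dim Lam
          (fun c => tensor_op (@celem E) iota (cleft c) idfun) d].

End LeftDimension.

(** * The index *)

Section Index.
Context {R : realType}.
Variables (H0 : hilbert R) (N : set (H0 -> H0)).
Variable Theta : (H0 -> H0) -> (H0 -> H0).
Variables (H : hilbert R) (pi : (H0 -> H0) -> (H -> H)).

Definition stinespring_form (a1 : H0 -> H0) (h1 : H) (a2 : H0 -> H0) (h2 : H) :
    R[i] := dot h1 (pi (Theta (adj a1 \o a2)) h2).

Definition arveson_stinespring (K : hilbert R) (iota : (H0 -> H0) -> H -> K) :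
    correspondence H :=
  {| cambient := (H -> K) ;
     celem := [set X | bounded_op X /\ forall a, N a ->
       X \o pi a = tensor_op N iota (fun b => a \o b) idfun \o X] ;
     cright := fun X c => X \o c ;
     cleft := fun c X => tensor_op N iota idfun c \o X ;
     cinner := fun X Y => adj X \o Y |}.

Variable tau : (H -> H) -> R[i].

Definition is_index (d : \bar R) : Prop :=
  exists (K : hilbert R) (iota : (H0 -> H0) -> H -> K),
    tensor_completion N stinespring_form iota /\
    is_left_dim (commutant (pi @` N)) tau (arveson_stinespring iota) d.

(* The auxiliary choices in [is_index] do not affect its value; the default -oo
   is not a value of a dimension. *)
Definition cp_index : \bar R := xget -oo%E is_index.

End Index.

(* Main.v *)
From HB Require Import structures.
Require Import Defs.
From mathcomp Require Import all_boot all_order all_algebra complex.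
From mathcomp Require Import all_classical all_reals all_analysis.
From mathcomp Require Import ring lra.

Set Implicit Arguments.
Unset Strict Implicit.
Unset Printing Implicit Defensive.

Import Order.TTheory GRing.Theory Num.Theory numFieldNormedType.Exports.
Local Open Scope classical_set_scope.
Local Open Scope complex_scope.
Local Open Scope ring_scope.

(* Let N ⊗_Θ H be a Stinespring space K. Since the form of a1 ⊗ h1 and a2 ⊗ h2 is
   \sum_k <pi(a1 t_k^* ) h1, pi(a2 t_k^* ) h2>, the maps a ⊗ h |-> pi(a t_k^* ) h
   are the components U_k : K -> H of an isometry into H^n, so that
   \sum_k U_k^* U_k = 1. The U_k intertwine the actions of N and of M = pi(N)',
   whence U_j U_k^* is in the centre of the factor pi(N): U_j U_k^* = C_jk 1. The
   matrix C is a self-adjoint idempotent whose kernel is the space of linear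
   relations between the t_k, so rank C = tr C is the dimension of their span.

   The correspondence consists of the X = \sum_k U_k^* x_k with x_k = U_k X in M,
   and its tensor product with L2(M) has again components Q_k into L2(M), with
   Q_j Q_k^* = C_jk 1, intertwining the left actions. Hence its left dimension is
   tr C: the class of 1 in L2(M) is a trace vector for the commutant of the left
   multiplications, which turns the sum of the tau(p_jj) into Parseval's formula.
   That the dimension is attained is seen on u = (Q_k)_k, with p_jk = C_jk 1. *)

(** * Hilbert spaces and bounded operators *)

(** [adj], [bounded_ext] and [cp_index] choose a value and have a default, so each formula for them
    rests on an existence proof. Hence the Riesz theorem, the extension of operators from dense
    ranges and the Hilbert spaces of positive kernels. The direct sum H^n is never formed: an
    isometry V into it is kept as the family of its components. In these terms C is the matrix of V
    V^*, which explains that it is idempotent, and pi(t_j^* ) h = U_j (1 ⊗ h) turns relations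
    between the U_k into relations between the t_k and back. The obstacle is uniqueness of the left
    dimension: K0, its basis and u are arbitrary, and tau(p_jj) = |u^* (Om ⊗ e_j)|^2, where Om is
    the class of 1, involves u^*, whereas Parseval sums the components of a vector u w. The trace
    vector property exchanges an operator of the commutant with its adjoint, without identifying
    that commutant with the right multiplications. *)

Section Discriminant.
Context {R : realType}.
Implicit Types a c z : R[i].

Lemma real_complexP (s : R) : s%:C \is Num.real.
Proof. by rewrite complex_real eqxx. Qed.

Lemma conj_realc (s : R) : (s%:C)^* = s%:C :> R[i].
Proof. exact/CrealP/real_complexP. Qed.

Lemma ge0_realc z : 0 <= z -> z = (complex.Re z)%:C.
Proof. by move=> /ger0_real /RRe_real. Qed.

(** Taking [l] to be a real multiple -s of the conjugate of [z] leaves a real quadratic polynomial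
    in s. This is the common core of Cauchy-Schwarz for inner products and for kernels, and of the
    estimate for near-minimizers in [riesz]. *)
Lemma discriminant_le a c z : 0 <= c ->
  (forall l : R[i], 0 <= a + (l * z + (l * z)^*) + `|l| ^+ 2 * c) ->
  `|z| ^+ 2 <= a * c.
Proof.
move=> c0 h.
have a0 : 0 <= a.
  by have := h 0; rewrite !mul0r rmorph0 normr0 expr0n mul0r !addr0.
have sq (s : R) :
    0 <= a - (2 * s)%:C * `|z| ^+ 2 + (s ^+ 2)%:C * (`|z| ^+ 2 * c).
  have := h (- s%:C * z^*).
  suff -> : - s%:C * z^* * z + (- s%:C * z^* * z)^* = - ((2 * s)%:C * `|z| ^+ 2).
    suff -> : `|- s%:C * z^*| ^+ 2 * c = (s ^+ 2)%:C * (`|z| ^+ 2 * c) by [].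
    rewrite normrM normrN norm_conjC exprMn.
    by rewrite real_normK ?real_complexP// -mulrA (rmorphXn (real_complex R)).
  rewrite !rmorphM !rmorphN /= conj_realc conjCK normCK.
  rewrite rmorph_nat; ring.
move: sq.
have /ge0_realc -> : 0 <= `|z| ^+ 2 by rewrite exprn_ge0.
rewrite (ge0_realc a0) (ge0_realc c0).
set x := complex.Re (`|z| ^+ 2); set A := complex.Re a; set C := complex.Re c.
have x0 : 0 <= x by rewrite -ler0c -ge0_realc// exprn_ge0.
have A0 : 0 <= A by rewrite -ler0c -ge0_realc.
have C0 : 0 <= C by rewrite -ler0c -ge0_realc.
move=> sq.
have {}sq s : 0 <= A - 2 * s * x + s ^+ 2 * (x * C).
  by have := sq s; rewrite -!rmorphM -rmorphB -rmorphD ler0c.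
rewrite -rmorphM lecR.
(* For C = 0 the polynomial is affine in s; if x > 0, the chosen s gives it the value -1. *)
have [c00|cn0] := eqVneq C 0.
  rewrite c00 mulr0 leNgt; apply/negP => xp.
  have := sq ((A + 1) / (2 * x)); rewrite c00 !mulr0 addr0.
  have -> : 2 * ((A + 1) / (2 * x)) * x = A + 1 by field; rewrite gt_eqF.
  by rewrite opprD addNKr lerNr oppr0 ler10.
have cp : 0 < C by rewrite lt_def cn0.
(* The minimum of the quadratic polynomial is at s = 1/C. *)
have := sq C^-1.
have -> : A - 2 * C^-1 * x + C^-1 ^+ 2 * (x * C) = A - x / C by field.
by rewrite subr_ge0 ler_pdivrMr.
Qed.

End Discriminant.

Section HilbertBasics.
Context {R : realType}.
Implicit Types H K : hilbert R.

Lemma dotDr H (x y z : H) : dot x (y + z) = dot x y + dot x z.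
Proof. by rewrite /dot linearDl. Qed.
Lemma dotDl H (x y z : H) : dot (x + y) z = dot x z + dot y z.
Proof. by rewrite /dot linearDr. Qed.
Lemma dotZr H c (x y : H) : dot x (c *: y) = c * dot x y.
Proof. by rewrite /dot linearZl_LR. Qed.
Lemma dotZl H c (x y : H) : dot (c *: x) y = c^* * dot x y.
Proof. by rewrite /dot linearZr_LR. Qed.
Lemma dot0r H (x : H) : dot x 0 = 0.
Proof. by rewrite /dot linear0l. Qed.
Lemma dot0l H (x : H) : dot 0 x = 0.
Proof. by rewrite /dot linear0r. Qed.
Lemma dotNr H (x y : H) : dot x (- y) = - dot x y.
Proof. by rewrite /dot linearNl. Qed.
Lemma dotNl H (x y : H) : dot (- x) y = - dot x y.
Proof. by rewrite /dot linearNr. Qed.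
Lemma dotBr H (x y z : H) : dot x (y - z) = dot x y - dot x z.
Proof. by rewrite dotDr dotNr. Qed.
Lemma dotBl H (x y z : H) : dot (x - y) z = dot x z - dot y z.
Proof. by rewrite dotDl dotNl. Qed.
Lemma dotC H (x y : H) : dot x y = (dot y x)^*.
Proof. by rewrite /dot hermC expr0 mul1r. Qed.

Lemma dot_sumr H I (r : seq I) (P : pred I) (x : H) (F : I -> H) :
  dot x (\sum_(i <- r | P i) F i) = \sum_(i <- r | P i) dot x (F i).
Proof. by apply: (big_morph (dot x)) => [y z|]; rewrite ?dotDr ?dot0r. Qed.
Lemma dot_suml H I (r : seq I) (P : pred I) (x : H) (F : I -> H) :
  dot (\sum_(i <- r | P i) F i) x = \sum_(i <- r | P i) dot (F i) x.
Proof.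
by apply: (big_morph (fun y => dot y x)) => [y z|]; rewrite ?dotDl ?dot0l.
Qed.

Lemma dotxx H (x : H) : dot x x = `|x| ^+ 2.
Proof. by rewrite /dot hnormE. Qed.

Lemma dotxx_ge0 H (x : H) : 0 <= dot x x.
Proof. by rewrite dotxx exprn_ge0. Qed.

Lemma dotxx_eq0 H (x : H) : dot x x = 0 -> x = 0.
Proof. by rewrite dotxx => /eqP; rewrite sqrf_eq0 normr_eq0 => /eqP. Qed.

Lemma dot_ext H (x y : H) : (forall z, dot z x = dot z y) -> x = y.
Proof.
move=> h; apply/eqP; rewrite -subr_eq0; apply/eqP/dotxx_eq0.
by rewrite dotBr h subrr.
Qed.

Lemma hilbert_cauchy_schwarz H (x y : H) : `|dot x y| <= `|x| * `|y|.
Proof.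
rewrite -ler_sqr ?nnegrE ?mulr_ge0// exprMn -!dotxx.
apply: discriminant_le => [|l]; first exact: dotxx_ge0.
have := dotxx_ge0 (x + l *: y).
rewrite dotDl !dotDr !dotZl !dotZr.
suff -> : dot x x + l * dot x y + (l^* * dot y x + l^* * (l * dot y y)) =
    dot x x + (l * dot x y + (l * dot x y)^*) + `|l| ^+ 2 * dot y y by [].
by rewrite rmorphM /= -dotC normCK; ring.
Qed.

Lemma bounded_opP H K (T : H -> K) :
  bounded_op T <->
  linear T /\ exists C : R, 0 <= C /\ forall x, `|T x| <= C%:C * `|x|.
Proof.
split=> -[lT].
  move=> cT; split=> //.
  pose f : {linear H -> K} := HB.pack T (GRing.isLinear.Build _ _ _ _ T lT).
  have /linear_bounded_continuous/linear_boundedP [M [Mr hM]] : continuous f by [].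
  have M0 : M < (`|complex.Re M| + 1)%:C.
    rewrite -{1}(RRe_real Mr) ltcR; apply: (le_lt_trans (ler_norm _)).
    by rewrite ltrDl.
  by exists (`|complex.Re M| + 1); split=> [|x]; [rewrite addr_ge0|exact: hM].
move=> [C [C0 hC]]; split=> //.
pose f : {linear H -> K} := HB.pack T (GRing.isLinear.Build _ _ _ _ T lT).
suff : continuous f by [].
apply/linear_bounded_continuous/linear_boundedP.
exists C%:C; split; first exact: real_complexP.
by move=> x /ltW Cx y; apply: (le_trans (hC y)); rewrite ler_wpM2r.
Qed.

(** Norms take values in [R[i]]. This lemma, its converse and [hilbert_complete] express density and
    completeness with real tolerances. *)
Lemma dense_approx H (S : set H) (x : H) (e : R) : dense S -> 0 < e ->
  exists2 y, S y & `|x - y| <= e%:C.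
Proof.
move=> dS e0.
have e0' : 0 < e%:C :> R[i] by rewrite ltcR.
have [||y [xy Sy]] := dS (ball x e%:C)^°.
- by exists x; apply: nbhsx_ballx.
- exact: open_interior.
- exists y => //; have := interior_subset xy.
  by rewrite -ball_normE /= => /ltW.
Qed.

Lemma approx_dense H (S : set H) :
  (forall x (e : R), 0 < e -> exists2 y, S y & `|x - y| <= e%:C) -> dense S.
Proof.
move=> h O [x Ox] oO.
have /nbhs_ballP [e /= e0 be] : nbhs x O by exact: open_nbhs_nbhs.
have er : e = (complex.Re e)%:C by apply: ge0_realc; exact: ltW.
have [|y Sy xy] := h x (complex.Re e / 2).
  by rewrite divr_gt0// -ltcR -er.
exists y; split=> //; apply: be; rewrite -ball_normE /=.
apply: (le_lt_trans xy); rewrite er ltcR.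
by rewrite ltr_pdivrMr// ltr_pMr ?ltr1n// -ltcR -er.
Qed.

Lemma hilbert_complete H (z : nat -> H) :
  (forall e : R, 0 < e -> exists n0, forall m n, (n0 <= m)%N -> (n0 <= n)%N ->
     `|z m - z n| <= e%:C) ->
  exists l : H, forall e : R, 0 < e -> exists n0, forall n, (n0 <= n)%N ->
     `|l - z n| <= e%:C.
Proof.
move=> hz.
have cz : cvg (z @ \oo).
  apply: cauchy_cvg; apply: cauchy_exP => e e0.
  have er : e = (complex.Re e)%:C by apply: ge0_realc; exact: ltW.
  have [|n0 hn] := hz (complex.Re e / 2); first by rewrite divr_gt0// -ltcR -er.
  exists (z n0); exists n0 => // n /= hnn; rewrite -ball_normE /=.
  apply: (le_lt_trans (hn _ _ (leqnn _) hnn)); rewrite er ltcR.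
  by rewrite ltr_pdivrMr// ltr_pMr ?ltr1n// -ltcR -er.
exists (lim (z @ \oo)) => e e0.
have /cvgrPdist_le /(_ e%:C) := cz.
by rewrite ltcR => /(_ e0) [n0 _ hn0]; exists n0 => n hn; apply: hn0.
Qed.

End HilbertBasics.

(** * The Riesz theorem and adjoints *)

Section Operators.
Context {R : realType}.
Implicit Types H K L : hilbert R.

(** The order of [R[i]] is partial: the case e = 1 already makes the imaginary parts equal, and the
    real parts are then compared as usual. The factor [A] saves rescaling e at each use. *)
Lemma ler_epsc (u v : R[i]) (A : R) : 0 <= A ->
  (forall e : R, 0 < e -> u <= v + (A * e)%:C) -> u <= v.
Proof.
move=> A0 h; rewrite lecE.
have := h 1 ltr01; rewrite lecE => /andP[/eqP + _].
case: u v h => u1 u2 [v1 v2] /= h; rewrite addr0 => ->; rewrite eqxx /=.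
apply/ler_addgt0Pr => e e0.
have A1 : 0 < A + 1 by rewrite ltr_wpDl.
have := h (e / (A + 1)); rewrite divr_gt0// => /(_ isT).
rewrite lecE /= => /andP[_ /le_trans]; apply; rewrite lerD2l.
by rewrite mulrCA ger_pMr// ler_pdivrMr// mul1r lerDl.
Qed.

Lemma norm_eps0 H (x : H) (A : R) : 0 <= A ->
  (forall e : R, 0 < e -> `|x| <= (A * e)%:C) -> x = 0.
Proof.
move=> A0 h; apply/eqP; rewrite -normr_eq0 eq_le normr_ge0 andbT.
by apply: (ler_epsc A0) => e e0; rewrite add0r; exact: h.
Qed.

Lemma invS_small (e : R) : 0 < e ->
  exists n0, forall n, (n0 <= n)%N -> n.+1%:R^-1 <= e.
Proof.
move=> e0; have [n0 _ h] := near_infty_natSinv_lt (PosNum e0).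
by exists n0 => n hn; apply: ltW; apply: h.
Qed.

(** The representing vector minimizes J x = |x|^2 - 2 Re (f x), which is bounded below by -C^2. A
    vector x with J x < inf J + e^2 represents [f] up to a functional of norm at most e, so
    near-minimizers form a Cauchy sequence. *)
Lemma riesz H (f : H -> R[i]) (C : R) :
  (forall c x y, f (c *: x + y) = c * f x + f y) ->
  (forall x, `|f x| <= C%:C * `|x|) ->
  exists z, forall x, f x = dot z x.
Proof.
move=> fl fC.
have f0 : f 0 = 0.
  have := fl (-1) 0 0; rewrite scaleN1r oppr0 addr0 mulN1r => ->.
  by rewrite addNr.
have fD x y : f (x + y) = f x + f y by rewrite -[x]scale1r fl mul1r scale1r.
have fZ c x : f (c *: x) = c * f x by rewrite -[c *: x]addr0 fl f0 addr0.
pose J x : R := complex.Re (dot x x - (f x + (f x)^*)).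
have fr x : f x + (f x)^* \is Num.real.
  by apply/CrealP; rewrite rmorphD /= conjCK addrC.
have JC x : (J x)%:C = dot x x - (f x + (f x)^*).
  by apply: RRe_real; rewrite rpredB// ger0_real// dotxx_ge0.
pose m := inf (range J).
have lbJ : has_inf (range J).
  split; first by exists (J 0); exists 0.
  exists (- C ^+ 2) => _ [x _ <-].
  rewrite -lecR JC lerBrDr.
  have h : f x + (f x)^* <= 2 * (C%:C * `|x|).
    apply: (le_trans (real_ler_norm (fr x))); apply: (le_trans (ler_normD _ _)).
    by rewrite norm_conjC mulr_natl mulr2n lerD.
  have : 0 <= (C%:C - `|x|) ^+ 2.
    by rewrite real_exprn_even_ge0// rpredB ?real_complexP// ger0_real.
  rewrite dotxx => h2; rewrite -subr_ge0; move: h; rewrite -subr_ge0 => h.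
  apply: (le_trans (addr_ge0 h h2)).
  by rewrite rmorphN rmorphXn /= le_eqVlt; apply/orP; left; apply/eqP; ring.
have step (e : R) : 0 < e -> exists x, forall h, `|dot x h - f h| <= e%:C * `|h|.
  move=> e0.
  have e0c : 0 <= e%:C :> R[i] by rewrite ler0c ltW.
  have e20 : 0 < e ^+ 2 by rewrite exprn_gt0.
  have [_ [x _ <-] hx] := inf_adherent e20 lbJ.
  exists x => h.
  rewrite -ler_sqr ?nnegrE ?mulr_ge0// exprMn -dotxx.
  rewrite -[e%:C ^+ 2](rmorphXn (real_complex R)).
  (* Nonnegativity of the quadratic form is J (x + l h) >= inf J > J x - e^2. *)
  apply: discriminant_le => [|l]; first exact: dotxx_ge0.
  have : m <= J (x + l *: h) by apply: ge_inf; [case: lbJ|exists (x + l *: h)].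
  move=> /(lt_le_trans _); move: hx; rewrite -ltrBlDr => hx /(_ _ hx) {hx}.
  rewrite ltrBlDr -ltcR rmorphD /= !JC => /ltW; rewrite -subr_ge0 => hx.
  apply: (le_trans hx); rewrite le_eqVlt; apply/orP; left; apply/eqP.
  rewrite fD fZ dotDl !dotDr !dotZl !dotZr.
  rewrite !(rmorphD, rmorphM, rmorphN, rmorphB) /= -dotC normCK.
  ring.
have [x hx] : exists x : nat -> H,
    forall n h, `|dot (x n) h - f h| <= (n.+1%:R^-1)%:C * `|h|.
  have h n : exists x : H, forall h, `|dot x h - f h| <= (n.+1%:R^-1)%:C * `|h|.
    by apply: step; rewrite invr_gt0.
  by have [x hx] := choice h; exists x.
have [|z hz] := @hilbert_complete _ H x.
  move=> e e0.
  have [|n0 hn0] := @invS_small (e / 2); first by rewrite divr_gt0.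
  exists n0 => k n hm hn.
  (* Both approximate representations of [f] are tested on the vector x_k - x_n itself; one factor
     of its norm then cancels. *)
  suff h : `|dot (x k - x n) (x k - x n)| <= e%:C * `|x k - x n|.
    move: h; rewrite dotxx ger0_norm ?exprn_ge0// expr2.
    have [->|nz] := eqVneq (`|x k - x n|) 0; first by move=> _; rewrite ler0c ltW.
    by rewrite ler_pM2r// normr_gt0 -normr_eq0.
  rewrite dotBl.
  set d := x k - x n.
  have -> : dot (x k) d - dot (x n) d = (dot (x k) d - f d) - (dot (x n) d - f d).
    by ring.
  apply: (le_trans (ler_normB _ _)).
  apply: (le_trans (lerD (hx k d) (hx n d))).
  rewrite -mulrDl -rmorphD ler_wpM2r// lecR.
  by rewrite [leRHS]splitr lerD ?hn0.
exists z => h; apply/eqP; rewrite eq_sym -subr_eq0 -normr_eq0.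
rewrite eq_le normr_ge0 andbT.
have [h0 h0E] : exists a : R, `|h| = a%:C.
  by exists (complex.Re `|h|); apply: ge0_realc.
have h00 : 0 <= h0 by rewrite -ler0c -h0E.
apply: (@ler_epsc _ _ (2 * h0)) => [|e e0]; first by rewrite mulr_ge0.
rewrite add0r.
have [n1 hn1] := hz _ e0; have [n2 hn2] := invS_small e0.
pose n := maxn n1 n2.
have -> : dot z h - f h = dot (z - x n) h + (dot (x n) h - f h).
  by rewrite dotBl; ring.
apply: (le_trans (ler_normD _ _)).
have le1 := le_trans (hilbert_cauchy_schwarz (z - x n) h)
  (ler_wpM2r (normr_ge0 h) (hn1 n (leq_maxl _ _))).
apply: (le_trans (lerD le1 (hx n h))).
rewrite h0E -!rmorphM -rmorphD lecR -mulrA -mulrDl mulrC.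
rewrite mulrCA ler_wpM2l// mulr_natl mulr2n.
by rewrite lerD2l hn2// leq_maxr.
Qed.

Lemma adj_exists H K (T : H -> K) : bounded_op T ->
  exists S : K -> H, bounded_op S /\ forall x y, dot (T x) y = dot x (S y).
Proof.
move=> /bounded_opP[lT [C [C0 hC]]].
have [S hS] : exists S : K -> H, forall y x, dot y (T x) = dot (S y) x.
  have h (y : K) : exists z : H, forall x, dot y (T x) = dot z x.
    apply: (@riesz _ _ (complex.Re `|y| * C)) => [c u v|x].
      by rewrite lT dotDr dotZr.
    apply: (le_trans (hilbert_cauchy_schwarz _ _)).
    by rewrite rmorphM /= -ge0_realc// -mulrA ler_wpM2l.
  by have [S hS] := choice h; exists S.
have {}hS x y : dot (T x) y = dot x (S y) by rewrite dotC hS -dotC.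
exists S; split=> //; apply/bounded_opP; split.
  move=> c u v; apply: dot_ext => w.
  by rewrite -hS !dotDr !dotZr !hS.
exists C; split=> // y.
have h : `|dot (S y) (S y)| <= C%:C * `|S y| * `|y|.
  rewrite -hS; apply: (le_trans (hilbert_cauchy_schwarz _ _)).
  by rewrite ler_wpM2r.
move: h; rewrite dotxx ger0_norm ?exprn_ge0// expr2.
have [->|nz] := eqVneq (`|S y|) 0; first by move=> _; rewrite mulr_ge0// ler0c.
by rewrite mulrAC ler_pM2r// normr_gt0 -normr_eq0.
Qed.

Lemma adj_spec H K (T : H -> K) : bounded_op T ->
  bounded_op (adj T) /\ forall x y, dot (T x) y = dot x (adj T y).
Proof. by move=> /adj_exists; apply: xgetPex. Qed.

Lemma bounded_adj H K (T : H -> K) : bounded_op T -> bounded_op (adj T).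
Proof. by case/adj_spec. Qed.

Lemma dot_adjr H K (T : H -> K) x y : bounded_op T ->
  dot (T x) y = dot x (adj T y).
Proof. by case/adj_spec. Qed.

Lemma dot_adjl H K (T : H -> K) x y : bounded_op T ->
  dot (adj T y) x = dot y (T x).
Proof. by move=> bT; rewrite dotC -dot_adjr// -dotC. Qed.

Lemma adj_unique H K (T : H -> K) (S : K -> H) : bounded_op T ->
  (forall x y, dot (T x) y = dot x (S y)) -> adj T = S.
Proof.
move=> bT hS; apply/funext => y; apply: dot_ext => x.
by rewrite -dot_adjr.
Qed.

Lemma adjK H K (T : H -> K) : bounded_op T -> adj (adj T) = T.
Proof.
move=> bT; apply: adj_unique; first exact: bounded_adj.
by move=> x y; rewrite dot_adjl.
Qed.

Lemma bounded_linear H K (T : H -> K) : bounded_op T ->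
  forall c x y, T (c *: x + y) = c *: T x + T y.
Proof. by case. Qed.

Lemma bounded0 H K (T : H -> K) : bounded_op T -> T 0 = 0.
Proof.
by move=> /bounded_linear/(_ (-1) 0 0); rewrite !scaleN1r oppr0 addr0 addNr.
Qed.

Lemma boundedD H K (T : H -> K) x y : bounded_op T -> T (x + y) = T x + T y.
Proof. by move=> /bounded_linear/(_ 1 x y); rewrite !scale1r. Qed.

Lemma boundedZ H K (T : H -> K) c x : bounded_op T -> T (c *: x) = c *: T x.
Proof.
by move=> bT; have := bounded_linear bT c x 0; rewrite (bounded0 bT) !addr0.
Qed.

Lemma bounded_sum H K (T : H -> K) I (r : seq I) (P : pred I) (F : I -> H) :
  bounded_op T -> T (\sum_(i <- r | P i) F i) = \sum_(i <- r | P i) T (F i).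
Proof.
move=> bT; apply: (big_morph T) => [x y|]; first exact: boundedD.
exact: bounded0.
Qed.

Lemma bounded_bound H K (T : H -> K) : bounded_op T ->
  exists C : R, 0 <= C /\ forall x, `|T x| <= C%:C * `|x|.
Proof. by case/bounded_opP. Qed.

Lemma bounded_id H : bounded_op (idfun : H -> H).
Proof. by apply/bounded_opP; split=> //; exists 1; split=> // x; rewrite mul1r. Qed.

Lemma bounded_comp H K L (S : K -> L) (T : H -> K) :
  bounded_op S -> bounded_op T -> bounded_op (S \o T).
Proof.
move=> bS bT; have [C [C0 hC]] := bounded_bound bS.
have [D [D0 hD]] := bounded_bound bT.
apply/bounded_opP; split=> [c x y|] /=.
  by rewrite (bounded_linear bT) (bounded_linear bS).
exists (C * D); split=> [|x]; first exact: mulr_ge0.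
by rewrite rmorphM -mulrA; apply: (le_trans (hC _)); rewrite ler_wpM2l ?ler0c.
Qed.

Lemma boundedP_add H K (S T : H -> K) :
  bounded_op S -> bounded_op T -> bounded_op (S + T).
Proof.
move=> bS bT; have [C [C0 hC]] := bounded_bound bS.
have [D [D0 hD]] := bounded_bound bT.
apply/bounded_opP; split=> [c x y|].
  by rewrite !fctE (bounded_linear bS) (bounded_linear bT) scalerDr addrACA.
exists (C + D); split=> [|x]; first exact: addr_ge0.
by rewrite rmorphD mulrDl fctE; apply: (le_trans (ler_normD _ _)); rewrite lerD.
Qed.

Lemma boundedP_scale H K (c : R[i]) (T : H -> K) :
  bounded_op T -> bounded_op (c *: T).
Proof.
move=> bT; have [D [D0 hD]] := bounded_bound bT.
apply/bounded_opP; split=> [d x y|].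
  by rewrite !fctE (bounded_linear bT) scalerDr !scalerA [c * d]mulrC.
have [r rE] : exists r : R, `|c| = r%:C.
  by exists (complex.Re `|c|); apply: ge0_realc.
have r0 : 0 <= r by rewrite -ler0c -rE.
exists (r * D); split=> [|x]; first exact: mulr_ge0.
by rewrite rmorphM /= fctE normrZ rE -mulrA ler_wpM2l ?ler0c.
Qed.

Lemma boundedP_zero H K : bounded_op (0 : H -> K).
Proof.
apply/bounded_opP; split=> [c x y|]; first by rewrite /= scaler0 addr0.
by exists 0; split=> // x; rewrite mul0r normr_le0.
Qed.

Lemma boundedP_sum H K I (r : seq I) (P : pred I) (F : I -> H -> K) :
  (forall i, P i -> bounded_op (F i)) ->
  bounded_op (\sum_(i <- r | P i) F i).
Proof.
move=> bF; apply: (big_ind (@bounded_op _ H K)) => //.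
- exact: boundedP_zero.
- exact: boundedP_add.
Qed.

Lemma adj_comp H K L (S : K -> L) (T : H -> K) :
  bounded_op S -> bounded_op T -> adj (S \o T) = adj T \o adj S.
Proof.
move=> bS bT; apply: adj_unique; first exact: bounded_comp.
by move=> x y /=; rewrite dot_adjr// dot_adjr.
Qed.

Lemma adj_id H : adj (idfun : H -> H) = idfun.
Proof. by apply: adj_unique => //; apply: bounded_id. Qed.

Lemma adj0 H K : adj (0 : H -> K) = 0.
Proof.
apply: adj_unique => [|x y]; first exact: boundedP_zero.
by rewrite dot0l dot0r.
Qed.

Lemma adj_linear H K c (S T : H -> K) : bounded_op S -> bounded_op T ->
  adj (c *: S + T) = c^* *: adj S + adj T.
Proof.
move=> bS bT; apply: adj_unique.
  by apply: boundedP_add => //; apply: boundedP_scale.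
by move=> x y; rewrite !fctE dotDl dotZl dotDr dotZr !dot_adjr.
Qed.

End Operators.

(** * Dense spans *)

Section LinSpan.
Context {R : realType}.
Implicit Types V : lmodType R[i].

Lemma lin_span_linear V (S : set V) c x y :
  lin_span S x -> lin_span S y -> lin_span S (c *: x + y).
Proof.
move=> [m [a [s [hs ->]]]] [n [b [t [ht ->]]]].
exists (m + n)%N.
exists (fun k => match fintype.split k with inl i => c * a i | inr j => b j end).
exists (fun k => match fintype.split k with inl i => s i | inr j => t j end); split.
  by move=> k; case: fintype.split.
rewrite big_split_ord scaler_sumr /=; congr (_ + _); apply: eq_bigr => i _.
  by rewrite (unsplitK (inl i)) scalerA.
by rewrite (unsplitK (inr i)).
Qed.

Lemma lin_span0 V (S : set V) : lin_span S 0.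
Proof.
by exists 0%N, (fun=> 0), (fun=> 0); split; [case|rewrite big_ord0].
Qed.

Lemma lin_span_incl V (S : set V) x : S x -> lin_span S x.
Proof.
move=> Sx; exists 1%N, (fun=> 1), (fun=> x); split=> //.
by rewrite big_ord1 scale1r.
Qed.

Lemma lin_span_min V (S P : set V) : P 0 ->
  (forall c x y, P x -> P y -> P (c *: x + y)) -> S `<=` P ->
  lin_span S `<=` P.
Proof.
move=> P0 PD SP _ [m [c [s [hs ->]]]].
apply: (big_rec P) => // i x _ Px; apply: PD => //.
by apply: SP.
Qed.

Lemma lin_spanZ V (S : set V) c x : lin_span S x -> lin_span S (c *: x).
Proof.
by move=> Sx; rewrite -[c *: x]addr0; apply: lin_span_linear => //; apply: lin_span0.
Qed.

Lemma lin_span_sum V (S : set V) I (r : seq I) (P : pred I) (F : I -> V) :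
  (forall i, P i -> lin_span S (F i)) -> lin_span S (\sum_(i <- r | P i) F i).
Proof.
move=> h; apply: (big_ind (lin_span S)) => //; first exact: lin_span0.
by move=> x y hx hy; rewrite -[x]scale1r; apply: lin_span_linear.
Qed.

Lemma lin_span_sub V (S S' : set V) :
  S `<=` lin_span S' -> lin_span S `<=` lin_span S'.
Proof.
by move=> h; apply: lin_span_min => //;
  [exact: lin_span0|exact: lin_span_linear].
Qed.

End LinSpan.

Section DenseSpan.
Context {R : realType}.
Implicit Types H K L : hilbert R.

Lemma dense_sub H (S S' : set H) : S `<=` S' -> dense S -> dense S'.
Proof. by move=> SS dS O O0 oO; have [x [Ox /SS Sx]] := dS O O0 oO; exists x. Qed.

Lemma ge0_ex_realc (u : R[i]) : 0 <= u -> exists r : R, 0 <= r /\ u = r%:C.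
Proof.
move=> u0; have uE := ge0_realc u0; exists (complex.Re u); split=> //.
by rewrite -ler0c -uE.
Qed.

(** Letting x in [S] tend to [v] gives |v|^2 <= C |v|. *)
Lemma dense_dot_le H (S : set H) (v : H) (C : R[i]) : 0 <= C -> dense S ->
  (forall x, S x -> `|dot x v| <= C * `|x|) -> `|v| <= C.
Proof.
move=> C0 dS h.
suff hv : `|v| ^+ 2 <= C * `|v|.
  have [->//|nz] := eqVneq (`|v|) 0.
  by move: hv; rewrite expr2 ler_pM2r// normr_gt0 -normr_eq0.
have [c [c0 cE]] := ge0_ex_realc C0.
have [r [r0 rE]] := ge0_ex_realc (normr_ge0 v).
apply: (@ler_epsc _ _ _ (r + c)) => [|e e0]; first exact: addr_ge0.
have [x Sx xv] := dense_approx v dS e0.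
rewrite -[_ ^+ 2]ger0_norm ?exprn_ge0// -dotxx -{1}(subrK x v) dotDl.
apply: (le_trans (ler_normD _ _)).
have h1 := le_trans (hilbert_cauchy_schwarz (v - x) v) (ler_wpM2r (normr_ge0 v) xv).
apply: (le_trans (lerD h1 (h _ Sx))).
have h2 : `|x| <= `|v| + e%:C.
  by rewrite -lerBlDl; apply: (le_trans (lerB_dist _ _)); rewrite distrC.
apply: (le_trans (lerD (lexx _) (ler_wpM2l C0 h2))).
rewrite rE cE -!(rmorphM, rmorphD) lecR le_eqVlt; apply/orP; left; apply/eqP; ring.
Qed.

Lemma dense_span_dot_ext H (S : set H) (v w : H) : dense (lin_span S) ->
  (forall x, S x -> dot x v = dot x w) -> v = w.
Proof.
move=> dS h; apply/eqP; rewrite -subr_eq0 -normr_eq0 eq_le normr_ge0 andbT.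
apply: (dense_dot_le (lexx 0) dS) => x; rewrite mul0r => Sx.
suff -> : dot x (v - w) = 0 by rewrite normr0.
move: x Sx; apply: lin_span_min => [|c x y /= h1 h2|x Sx] /=.
- by rewrite dot0l.
- by rewrite dotDl dotZl h1 h2 mulr0 addr0.
- by rewrite dotBr h// subrr.
Qed.

Lemma dense_span_op_ext H K (S : set H) (T U : H -> K) :
  bounded_op T -> bounded_op U -> dense (lin_span S) ->
  (forall x, S x -> T x = U x) -> T = U.
Proof.
move=> bT bU dS h; rewrite -(adjK bT) -(adjK bU); congr adj.
apply/funext => y; apply: (dense_span_dot_ext dS) => x Sx.
by rewrite -!dot_adjr// h.
Qed.

Lemma bounded_ext_unique X H K (D : set X) (f : X -> H) (g : X -> K) T :
  dense (lin_span (f @` D)) -> bounded_op T -> (forall x, D x -> T (f x) = g x) ->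
  bounded_ext D f g = T.
Proof.
move=> dD bT hT; rewrite /bounded_ext; case: xgetP => [S _ [bS hS]|/(_ T)[]//].
by apply: (dense_span_op_ext bS bT dD) => _ [x Dx <-]; rewrite hS// hT.
Qed.

(** The operator is built from its graph: the span G of the pairs (f x, g x) satisfies |p.2| <= C
    |p.1|, so its closure is the graph of an operator with the same bound. No choice of a
    representation of a vector as a combination of the [f x] is made. *)
Lemma bounded_ext_exists X H K (D : set X) (f : X -> H) (g : X -> K) (C : R) :
  0 <= C -> dense (lin_span (f @` D)) ->
  (forall m (c : 'I_m -> R[i]) (x : 'I_m -> X), (forall k, D (x k)) ->
    `|\sum_k c k *: g (x k)| <= C%:C * `|\sum_k c k *: f (x k)|) ->
  exists T : H -> K, bounded_op T /\ forall x, D x -> T (f x) = g x.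
Proof.
move=> C0 dD hD.
pose G (p : H * K) := lin_span [set (f x, g x) | x in D] p.
have GD c p q : G p -> G q -> G (c *: p.1 + q.1, c *: p.2 + q.2).
  exact: lin_span_linear.
have GC p : G p -> `|p.2| <= C%:C * `|p.1|.
  move=> [m [c [s [hs ->]]]].
  have hs' k : exists x, D x /\ (f x, g x) = s k.
    by have [x Dx <-] := hs k; exists x.
  have [x hx] := choice hs'.
  have e1 : (\sum_k c k *: s k).1 = \sum_k c k *: f (x k).
    rewrite (big_morph fst (id1 := 0) (op1 := +%R))//.
    by apply: eq_bigr => k _; case: (hx k) => _ <-.
  have e2 : (\sum_k c k *: s k).2 = \sum_k c k *: g (x k).
    rewrite (big_morph snd (id1 := 0) (op1 := +%R))//.
    by apply: eq_bigr => k _; case: (hx k) => _ <-.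
  by rewrite e1 e2; apply: hD => k; case: (hx k).
have GB p q : G p -> G q -> `|p.2 - q.2| <= C%:C * `|p.1 - q.1|.
  move=> Gp Gq; have := GC _ (GD (-1) _ _ Gq Gp).
  by rewrite /= !scaleN1r ![- _ + _]addrC.
have Gd v (e : R) : 0 < e -> exists2 p, G p & `|v - p.1| <= e%:C.
  move=> e0; have [y Sy vy] := dense_approx v dD e0.
  suff [p Gp pE] : exists2 p, G p & p.1 = y by exists p => //; rewrite pE.
  move: y Sy {vy}; apply: lin_span_min => [|c x y /= [p Gp <-] [q Gq <-]|_ [x Dx <-]].
  - by exists 0 => //; exact: lin_span0.
  - by exists (c *: p.1 + q.1, c *: p.2 + q.2) => //; exact: GD.
  - by exists (f x, g x) => //; apply: lin_span_incl; exists x.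
(* [E v w] says that (v, w) lies in the closure of G. Existence of w comes from completeness of K,
   its uniqueness from the bound on differences in G. *)
pose E v w := forall e : R, 0 < e ->
  exists2 p, G p & `|v - p.1| <= e%:C /\ `|w - p.2| <= e%:C.
have [T hT] : exists T : H -> K, forall v, E v (T v).
  suff h v : exists w, E v w by have [T hT] := choice h; exists T.
  have h n : exists p, G p /\ `|v - p.1| <= (n.+1%:R^-1)%:C.
    by have [|p] := @Gd v (n.+1%:R^-1); [rewrite invr_gt0|exists p].
  have [p hp] := choice h.
  have C1 : 0 < C + 1 by rewrite ltr_wpDl.
  have hpp (e : R) : 0 < e -> exists n0, forall n, (n0 <= n)%N -> `|v - (p n).1| <= e%:C.
    move=> e0; have [n0 hn0] := invS_small e0; exists n0 => n /hn0 hn.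
    by apply: (le_trans (proj2 (hp n))); rewrite lecR.
  have [|w hw] := @hilbert_complete _ K (fun n => (p n).2).
    move=> e e0; have e1 : 0 < e / (C + 1) / 2 by rewrite !divr_gt0.
    have [n0 hn0] := hpp _ e1; exists n0 => k n hk hn.
    apply: (le_trans (GB _ _ (proj1 (hp k)) (proj1 (hp n)))).
    have -> : (p k).1 - (p n).1 = (v - (p n).1) - (v - (p k).1).
      by rewrite opprB [RHS]addrC subrKA.
    have h3 := le_trans (ler_normB _ _) (lerD (hn0 n hn) (hn0 k hk)).
    rewrite -rmorphD -splitr in h3.
    have C0' : 0 <= C%:C :> R[i] by rewrite ler0c.
    apply: (le_trans (ler_wpM2l C0' h3)); rewrite -rmorphM lecR.
    by rewrite mulrCA ger_pMr// ler_pdivrMr// mul1r lerDl.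
  exists w => e e0; have [n1 h1] := hpp e e0; have [n2 h2] := hw e e0.
  exists (p (maxn n1 n2)); first by case: (hp (maxn n1 n2)).
  by rewrite h1 ?leq_maxl// h2 ?leq_maxr.
have Eu v w w' : E v w -> E v w' -> w = w'.
  move=> h h'; apply/eqP; rewrite -subr_eq0; apply/eqP.
  apply: (@norm_eps0 _ _ _ (2 + 2 * C)) => [|e e0]; first by rewrite addr_ge0 ?mulr_ge0.
  have [p Gp [p1 p2]] := h e e0; have [q Gq [q1 q2]] := h' e e0.
  have -> : w - w' = (w - p.2) + (p.2 - q.2) - (w' - q.2).
    by rewrite opprB !subrKA.
  apply: (le_trans (ler_normB _ _)).
  apply: (le_trans (lerD (ler_normD _ _) q2)).
  have h3 : `|p.1 - q.1| <= (2 * e)%:C.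
    have -> : p.1 - q.1 = (v - q.1) - (v - p.1) by rewrite opprB [RHS]addrC subrKA.
    apply: (le_trans (ler_normB _ _)); apply: (le_trans (lerD q1 p1)).
    by rewrite -rmorphD lecR mulr_natl mulr2n.
  have C0' : 0 <= C%:C :> R[i] by rewrite ler0c.
  have h4 := le_trans (GB _ _ Gp Gq) (ler_wpM2l C0' h3).
  apply: (le_trans (lerD (lerD p2 h4) (lexx _))).
  rewrite -!(rmorphM, rmorphD) lecR le_eqVlt; apply/orP; left; apply/eqP; ring.
exists T; split; last first.
  move=> x Dx; apply: (Eu (f x)) => // e e0; exists (f x, g x).
    by apply: lin_span_incl; exists x.
  by rewrite !subrr !normr0 ler0c ltW.
apply/bounded_opP; split.
  move=> c u v; apply: (Eu (c *: u + v)) => // e e0.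
  have [a [a0 aE]] := ge0_ex_realc (normr_ge0 c).
  have a1 : 0 < a + 1 by rewrite ltr_wpDl.
  have e1 : 0 < e / (a + 1) by rewrite divr_gt0.
  have [p Gp [p1 p2]] := hT u _ e1; have [q Gq [q1 q2]] := hT v _ e1.
  exists (c *: p.1 + q.1, c *: p.2 + q.2); first exact: GD.
  have aux (V : hilbert R) (x y x' y' : V) : `|x - x'| <= (e / (a + 1))%:C ->
      `|y - y'| <= (e / (a + 1))%:C ->
      `|c *: x + y - (c *: x' + y')| <= e%:C.
    move=> h h'; rewrite opprD addrACA -scalerBr.
    apply: (le_trans (ler_normD _ _)); rewrite normrZ aE.
    have a0' : 0 <= a%:C :> R[i] by rewrite ler0c.
    apply: (le_trans (lerD (ler_wpM2l a0' h) h')).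
    rewrite -rmorphM -rmorphD lecR -[X in _ + X]mul1r -mulrDl mulrC divfK//.
    by rewrite gt_eqF.
  by split; apply: aux.
exists C; split=> // v; apply: (@ler_epsc _ _ _ (1 + C)) => [|e e0].
  by rewrite addr_ge0.
have [p Gp [p1 p2]] := hT v e e0.
rewrite -{1}(subrK p.2 (T v)); apply: (le_trans (ler_normD _ _)).
have h2 : `|p.1| <= `|v| + e%:C.
  by rewrite -lerBlDl; apply: (le_trans (lerB_dist _ _)); rewrite distrC.
have C0' : 0 <= C%:C :> R[i] by rewrite ler0c.
apply: (le_trans (lerD p2 (le_trans (GC _ Gp) (ler_wpM2l C0' h2)))).
rewrite mulrDr addrCA lerD2l -rmorphM -rmorphD lecR mulrDl mul1r.
exact: lexx.
Qed.

(* [U k] is the [k]-th component of the isometry [f x |-> (g k x)_k]. *)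
Lemma isometry_components X H K n (D : set X) (f : X -> H) (g : 'I_n -> X -> K) :
  dense (lin_span (f @` D)) ->
  (forall x y, D x -> D y -> dot (f x) (f y) = \sum_k dot (g k x) (g k y)) ->
  exists U : 'I_n -> H -> K, [/\ forall k, bounded_op (U k),
    forall k x, D x -> U k (f x) = g k x &
    forall v, \sum_k adj (U k) (U k v) = v].
Proof.
move=> dD hD.
have hU k : exists T : H -> K, bounded_op T /\ forall x, D x -> T (f x) = g k x.
  apply: (bounded_ext_exists ler01 dD) => m c x Dx; rewrite mul1r.
  rewrite -ler_sqr ?nnegrE// -!dotxx.
  have -> : dot (\sum_i c i *: f (x i)) (\sum_i c i *: f (x i)) =
      \sum_j dot (\sum_i c i *: g j (x i)) (\sum_i c i *: g j (x i)).
    rewrite dot_suml.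
    under [RHS]eq_bigr do rewrite dot_suml.
    rewrite exchange_big /=; apply: eq_bigr => i _.
    under [RHS]eq_bigr do rewrite dot_sumr.
    rewrite dot_sumr exchange_big /=; apply: eq_bigr => j _.
    rewrite dotZl dotZr hD// !mulr_sumr; apply: eq_bigr => l _.
    by rewrite dotZl dotZr.
  by rewrite (bigD1 k)//= lerDl sumr_ge0// => j _; exact: dotxx_ge0.
have [U hU'] := choice hU.
exists U; split=> [k|k x Dx|]; first by case: (hU' k).
  by case: (hU' k) => _; apply.
have bU k : bounded_op (U k) by case: (hU' k).
suff h : (\sum_k (adj (U k) \o U k)) = idfun :> (H -> H).
  by move=> v; have := congr1 (fun F => F v) h; rewrite fct_sumE.
apply: (dense_span_op_ext _ (@bounded_id _ H) dD) => [|_ [y Dy <-]].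
  by apply: boundedP_sum => k _; apply: bounded_comp => //; apply: bounded_adj.
apply: (dense_span_dot_ext dD) => _ [x Dx <-].
rewrite fct_sumE dot_sumr /= hD//; apply: eq_bigr => k _.
by rewrite -dot_adjr//; case: (hU' k) => _ h; rewrite !h.
Qed.

End DenseSpan.

(** * Hilbert spaces of positive kernels *)

Lemma complex_complete (R : realType) (z : nat -> R[i]) :
  (forall e : R, 0 < e -> exists n0, forall m n, (n0 <= m)%N -> (n0 <= n)%N ->
     `|z m - z n| <= e%:C) ->
  exists l : R[i], forall e : R, 0 < e -> exists n0, forall n, (n0 <= n)%N ->
     `|l - z n| <= e%:C.
Proof.
move=> hz.
have real_lim (u : nat -> R) : (forall m n, `|u m - u n|%:C <= `|z m - z n|) ->
    exists l : R, forall e : R, 0 < e -> exists n0, forall n, (n0 <= n)%N ->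
     `|l - u n| <= e.
  move=> hu.
  have cu : cvg (u @ \oo).
    apply: cauchy_cvg; apply: cauchy_exP => e e0.
    have [|n0 hn] := hz (e / 2); first by rewrite divr_gt0.
    exists (u n0); exists n0 => // n /= hnn; rewrite -ball_normE /=.
    have := le_trans (hu n0 n) (hn _ _ (leqnn _) hnn); rewrite lecR.
    by move=> /le_lt_trans; apply; rewrite ltr_pdivrMr// ltr_pMr ?ltr1n.
  exists (lim (u @ \oo)) => e e0.
  have /cvgrPdist_le /(_ e e0) [n0 _ hn0] := cu.
  by exists n0 => n hn; apply: hn0.
have [a ha] : exists l : R, forall e : R, 0 < e -> exists n0, forall n, (n0 <= n)%N ->
     `|l - complex.Re (z n)| <= e.
  by apply: real_lim => m n; rewrite -raddfB; exact: normc_ge_Re.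
have [b hb] : exists l : R, forall e : R, 0 < e -> exists n0, forall n, (n0 <= n)%N ->
     `|l - complex.Im (z n)| <= e.
  apply: real_lim => m n; rewrite -raddfB.
  have := normc_ge_Re ((z m - z n) * 'i).
  rewrite ReiNIm normrN normrM [`|'i|](_ : _ = 1) ?mulr1//.
  by rewrite normc_def /= expr0n expr1n add0r sqrtr1.
exists (Complex a b) => e e0.
have e2 : 0 < e / 2 by rewrite divr_gt0.
have [n1 h1] := ha _ e2; have [n2 h2] := hb _ e2.
exists (maxn n1 n2) => n; rewrite geq_max => /andP[/h1 {}h1 /h2 {}h2].
have -> : Complex a b - z n = (a - complex.Re (z n))%:C + 'i * (b - complex.Im (z n))%:C.
  by rewrite [LHS]complexE !raddfB.
apply: (le_trans (ler_normD _ _)); rewrite normrM [`|'i|](_ : _ = 1).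
  rewrite mul1r [e]splitr [leRHS]rmorphD; apply: lerD; rewrite normc_def /= expr0n addr0;
    by rewrite sqrtr_sqr lecR.
by rewrite normc_def /= expr0n expr1n add0r sqrtr1.
Qed.

Record psd_kernel (R : realType) (X : Type) := PsdKernel {
  kfun :> X -> X -> R[i];
  kfun_psd : forall b : seq (R[i] * X),
    0 <= \sum_(p <- b) p.1^* * \sum_(q <- b) q.1 * kfun p.2 q.2 }.

Section Kernel.
Context {R : realType} {X : Type} (k : psd_kernel R X).
Implicit Types (f g : X -> R[i]) (b : seq (R[i] * X)).

(* A list of pairs [(c, x)] stands for the formal combination [\sum c x];
   [keval f] extends [f] to combinations antilinearly. *)
Definition keval f b : R[i] := \sum_(p <- b) p.1^* * f p.2.
Definition kcomb b : X -> R[i] := fun x => \sum_(q <- b) q.1 * k x q.2.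
Definition kscale (c : R[i]) b := [seq (c * p.1, p.2) | p <- b].

Lemma keval_linear c f g b : keval (c *: f + g) b = c * keval f b + keval g b.
Proof.
rewrite /keval mulr_sumr -big_split; apply: eq_bigr => p _ /=.
by rewrite !fctE mulrDr mulrCA.
Qed.

Lemma kevalB f g b : keval (f - g) b = keval f b - keval g b.
Proof. by rewrite addrC -scaleN1r keval_linear mulN1r addrC. Qed.

Lemma keval_cat f b b' : keval f (b ++ b') = keval f b + keval f b'.
Proof. by rewrite /keval big_cat. Qed.

Lemma keval_scale c f b : keval f (kscale c b) = c^* * keval f b.
Proof.
rewrite /keval big_map mulr_sumr; apply: eq_bigr => p _ /=.
by rewrite rmorphM mulrA.
Qed.

Lemma kcomb_linear c b b' : kcomb (kscale c b ++ b') = c *: kcomb b + kcomb b'.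
Proof.
apply/funext => x; rewrite /kcomb big_cat big_map !fctE; congr (_ + _).
by rewrite scaler_sumr; apply: eq_bigr => p _; exact: esym (mulrA _ _ _).
Qed.

Definition knorm2 b : R[i] := keval (kcomb b) b.

Lemma knorm2_ge0 b : 0 <= knorm2 b.
Proof. exact: kfun_psd. Qed.

Lemma knorm2_linear c b b' : knorm2 (kscale c b ++ b') =
  `|c| ^+ 2 * knorm2 b + c * keval (kcomb b) b' + c^* * keval (kcomb b') b + knorm2 b'.
Proof.
rewrite /knorm2 kcomb_linear keval_linear !keval_cat !keval_scale normCK; ring.
Qed.

(** Symmetry follows from positivity: with z and w the two evaluations, c z + c^* w is a real
    combination of values of [knorm2], hence real; c = 1 and c = i determine w. *)
Lemma keval_herm b b' : keval (kcomb b) b' = (keval (kcomb b') b)^*.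
Proof.
set z := keval (kcomb b) b'; set w := keval (kcomb b') b.
have h c : (c * z + c^* * w)^* = c * z + c^* * w.
  apply/CrealP.
  have -> : c * z + c^* * w = knorm2 (kscale c b ++ b') - `|c| ^+ 2 * knorm2 b - knorm2 b'.
    by rewrite knorm2_linear -/z -/w; ring.
  by rewrite !rpredB// ?rpredM ?rpredX ?ger0_real ?knorm2_ge0.
have := h 1; have := h 'i%C.
have ii : ('i%C : R[i])^* = - 'i%C by rewrite complexiE conjCi.
rewrite rmorph1 !mul1r !(rmorphD, rmorphM) /= ii rmorphN /= ii opprK => h1 h2.
have h3 : - z^* + w^* = z - w.
  apply: (@mulfI _ 'i%C); first by rewrite complexiE neq0Ci.
  by move: h1; rewrite !mulrDr !mulrN !mulNr.
have : 2 * w^* = 2 * z.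
  by transitivity ((z^* + w^*) + (- z^* + w^*)); [ring|rewrite h2 h3; ring].
by move=> /(@mulfI _ 2); rewrite pnatr_eq0 => /(_ isT).
Qed.

Definition knorm b : R := Num.sqrt (complex.Re (knorm2 b)).

Lemma knorm_ge0 b : 0 <= knorm b. Proof. exact: sqrtr_ge0. Qed.

Lemma knorm2E b : knorm2 b = (knorm b ^+ 2)%:C.
Proof.
have [r [r0 rE]] := ge0_ex_realc (knorm2_ge0 b).
by rewrite /knorm rE /= sqr_sqrtr.
Qed.

Lemma keval_cauchy_schwarz b b' :
  `|keval (kcomb b) b'| <= (knorm b * knorm b')%:C.
Proof.
have p0 : 0 <= (knorm b * knorm b')%:C :> R[i] by rewrite ler0c mulr_ge0 ?knorm_ge0.
rewrite -ler_sqr ?nnegrE// rmorphM exprMn.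
have kE c : (knorm c)%:C ^+ 2 = knorm2 c by rewrite knorm2E -rmorphXn.
rewrite !kE mulrC.
apply: discriminant_le => [|c]; first exact: knorm2_ge0.
suff -> : knorm2 b' + (c * keval (kcomb b) b' + (c * keval (kcomb b) b')^*) +
    `|c| ^+ 2 * knorm2 b = knorm2 (kscale c b ++ b') by exact: knorm2_ge0.
rewrite knorm2_linear rmorphM /= -keval_herm; ring.
Qed.

(* The Hilbert space of the kernel consists of the functions [f] for which
   [keval f] is a limit, in operator norm, of inner products with combinations. *)
Definition kbounded f (C : R) : Prop :=
  0 <= C /\ forall b, `|keval f b| <= (C * knorm b)%:C.

Definition knear f : Prop :=
  forall e : R, 0 < e -> exists b, kbounded (f - kcomb b) e.

Definition kopnorm f : R := inf [set C | kbounded f C].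

Lemma kbounded_comb b : kbounded (kcomb b) (knorm b).
Proof. by split=> [|b']; [exact: knorm_ge0|exact: keval_cauchy_schwarz]. Qed.

Lemma kbounded_linear c f g C D : kbounded f C -> kbounded g D ->
  kbounded (c *: f + g) (complex.Re `|c| * C + D).
Proof.
move=> [C0 fC] [D0 gD].
have [r [r0 rE]] := ge0_ex_realc (normr_ge0 c).
rewrite rE /=; split=> [|b]; first by rewrite addr_ge0 ?mulr_ge0.
rewrite keval_linear; apply: (le_trans (ler_normD _ _)); rewrite normrM rE.
have r0' : 0 <= r%:C :> R[i] by rewrite ler0c.
apply: (le_trans (lerD (ler_wpM2l r0' (fC b)) (gD b))).
by rewrite -rmorphM -rmorphD lecR mulrDl mulrA.
Qed.

Lemma kboundedD f g C D : kbounded f C -> kbounded g D -> kbounded (f + g) (C + D).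
Proof.
move=> hf hg; have := kbounded_linear 1 hf hg.
by rewrite scale1r normr1 mul1r.
Qed.

Lemma kbounded_near f : knear f -> exists C, kbounded f C.
Proof.
move=> /(_ 1 ltr01)[b hb]; exists (1 + knorm b).
by rewrite -[f](subrK (kcomb b)); apply: kboundedD => //; apply: kbounded_comb.
Qed.

Lemma kopnorm_le f C : kbounded f C -> kopnorm f <= C.
Proof. by move=> hC; apply: ge_inf => //; exists 0 => D []. Qed.

Lemma kopnorm_ge0 f : 0 <= kopnorm f.
Proof.
have [ne|ne] := pselect ([set C | kbounded f C] !=set0).
  by apply: lb_le_inf => // C [].
rewrite /kopnorm (_ : [set C | kbounded f C] = set0) ?inf0//.
by apply/seteqP; split=> // C hC; case: ne; exists C.
Qed.

(** The infimum is attained: a combination of norm 0 is evaluated to 0 under any bound, and for the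
    others one divides by the norm. *)
Lemma kbounded_kopnorm f : knear f -> kbounded f (kopnorm f).
Proof.
move=> /kbounded_near hf; split=> [|b]; first exact: kopnorm_ge0.
have [r [r0 rE]] := ge0_ex_realc (normr_ge0 (keval f b)).
rewrite rE lecR.
have [b0|bn0] := eqVneq (knorm b) 0.
  by have [C [_ /(_ b)]] := hf; rewrite b0 !mulr0 rE lecR.
have bp : 0 < knorm b by rewrite lt_def bn0 knorm_ge0.
rewrite -ler_pdivrMr//; apply: lb_le_inf => // C [C0 hC].
by rewrite ler_pdivrMr// -lecR -rE.
Qed.

Lemma knear_linear c f g : knear f -> knear g -> knear (c *: f + g).
Proof.
move=> hf hg e e0.
have [r [r0 rE]] := ge0_ex_realc (normr_ge0 c).
have r1 : 0 < r + 1 by rewrite ltr_wpDl.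
have e1 : 0 < e / (r + 1) by rewrite divr_gt0.
have [b hb] := hf _ e1; have [b' hb'] := hg _ e1.
exists (kscale c b ++ b'); rewrite kcomb_linear opprD addrACA -scalerBr.
have := kbounded_linear c hb hb'; rewrite rE /=.
by rewrite (_ : r * (e / (r + 1)) + e / (r + 1) = e)//; field; rewrite gt_eqF.
Qed.

Lemma knear_comb b : knear (kcomb b).
Proof.
move=> e e0; exists b; rewrite subrr; split=> [|b']; first exact: ltW.
rewrite [keval 0 b']big1 ?normr0 ?ler0c ?mulr_ge0 ?knorm_ge0// ?ltW//.
by move=> p _; rewrite mulr0.
Qed.

(** The lower bound comes from testing the functional of [b] on [b] itself. *)
Lemma kopnorm_comb b : kopnorm (kcomb b) = knorm b.
Proof.
apply/eqP; rewrite eq_le (kopnorm_le (kbounded_comb b)) /=.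
have [_ /(_ b)] := kbounded_kopnorm (knear_comb b).
have p0 : 0 <= (knorm b ^+ 2)%:C :> R[i] by rewrite ler0c sqr_ge0.
rewrite -/(knorm2 b) knorm2E (ger0_norm p0) lecR expr2.
have [->|nz] := eqVneq (knorm b) 0; first by rewrite kopnorm_ge0.
by rewrite ler_pM2r// lt_def nz knorm_ge0.
Qed.

End Kernel.

(** * The normed space of a kernel and its completeness *)

Section RKHS.
Context {R : realType} {X : Type} (k : psd_kernel R X).

Definition knear_pred : {pred X -> R[i]} := fun f => `[< knear k f >].

Lemma knear_predP f : reflect (knear k f) (f \in knear_pred).
Proof. exact: asboolP. Qed.

Lemma knear_submod_closed : submod_closed knear_pred.
Proof.
split.
  apply/knear_predP; have := knear_comb k [::].
  by rewrite [kcomb _ _](_ : _ = 0)//; apply/funext => x; rewrite /kcomb big_nil.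
move=> c f g /knear_predP hf /knear_predP hg; apply/knear_predP.
exact: knear_linear.
Qed.

HB.instance Definition _ := GRing.isSubmodClosed.Build R[i] (X -> R[i])
  knear_pred knear_submod_closed.

Record rkhs := Rkhs { rkhs_fun : X -> R[i]; rkhs_funP : rkhs_fun \in knear_pred }.

HB.instance Definition _ := [isSub for rkhs_fun].
HB.instance Definition _ := [Choice of rkhs by <:].
HB.instance Definition _ := [SubChoice_isSubLmodule of rkhs by <:].

Lemma rkhs_near (f : rkhs) : knear k (rkhs_fun f).
Proof. exact/knear_predP/rkhs_funP. Qed.

Lemma rkhs_linear c (f g : rkhs) :
  rkhs_fun (c *: f + g) = c *: rkhs_fun f + rkhs_fun g.
Proof. by []. Qed.

Lemma rkhs_funB (f g : rkhs) : rkhs_fun (f - g) = rkhs_fun f - rkhs_fun g.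
Proof. by []. Qed.

Definition rkhs_norm (f : rkhs) : R[i] := (kopnorm k (rkhs_fun f))%:C.

Lemma rkhs_normD f g : rkhs_norm (f + g) <= rkhs_norm f + rkhs_norm g.
Proof.
rewrite /rkhs_norm -rmorphD lecR; apply: kopnorm_le.
by apply: kboundedD; apply: kbounded_kopnorm; apply: rkhs_near.
Qed.

Lemma rkhs_norm0 : rkhs_norm 0 = 0.
Proof.
congr (_%:C); apply/eqP; rewrite eq_le kopnorm_ge0 andbT; apply: kopnorm_le.
split=> // b; rewrite mul0r [keval _ _]big1 ?normr0// => p _.
by rewrite mulr0.
Qed.

Lemma rkhs_norm_le c f : rkhs_norm (c *: f) <= `|c| * rkhs_norm f.
Proof.
have [r [r0 rE]] := ge0_ex_realc (normr_ge0 c).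
rewrite /rkhs_norm rE -rmorphM lecR; apply: kopnorm_le.
have := kbounded_linear c (kbounded_kopnorm (rkhs_near f))
  (kbounded_kopnorm (rkhs_near 0)).
have [n0] := rkhs_norm0.
by rewrite n0 rE -rkhs_linear !addr0.
Qed.

Lemma rkhs_normZ c f : rkhs_norm (c *: f) = `|c| * rkhs_norm f.
Proof.
apply/eqP; rewrite eq_le rkhs_norm_le /=.
have [->|c0] := eqVneq c 0; first by rewrite normr0 mul0r ler0c kopnorm_ge0.
rewrite -ler_pdivlMl ?normr_gt0//.
have := rkhs_norm_le c^-1 (c *: f).
by rewrite scalerA mulVf// scale1r normfV.
Qed.

Lemma rkhs_norm_bound f b : `|keval (rkhs_fun f) b| <= rkhs_norm f * (knorm k b)%:C.
Proof. by rewrite -rmorphM; case: (kbounded_kopnorm (rkhs_near f)). Qed.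

(** The value at x is, by [keval], the evaluation on the one-term combination of x, and so is
    controlled by the norm. *)
Lemma rkhs_norm_eq0 f : rkhs_norm f = 0 -> f = 0.
Proof.
move=> f0; apply: val_inj; apply/funext => x /=.
have := rkhs_norm_bound f [:: (1, x)].
by rewrite f0 mul0r normr_le0 /keval big_seq1 /= conjC1 mul1r => /eqP.
Qed.

HB.instance Definition _ := @Lmodule_isNormed.Build R[i] rkhs rkhs_norm
  rkhs_normD rkhs_normZ rkhs_norm_eq0.

Lemma rkhs_normE (f : rkhs) : `|f| = (kopnorm k (rkhs_fun f))%:C.
Proof. by []. Qed.

(** A Cauchy sequence is extracted from the filter; its pointwise limit [l] is shown to be its limit
    in operator norm, and therefore to be again near combinations. *)
Lemma rkhs_complete (F : set_system rkhs) : ProperFilter F -> cauchy F -> cvg F.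
Proof.
move=> FF /cauchyP cF.
have hf n : exists f : rkhs, F (ball f (n.+1%:R^-1)%:C).
  by apply: cF; rewrite ltcR invr_gt0.
have [f {}hf] := choice hf.
have fB m n : `|f m - f n| <= (m.+1%:R^-1 + n.+1%:R^-1)%:C.
  have [g [gm gn]] := filter_ex (filterI (hf m) (hf n)).
  move: gm gn; rewrite -ball_normE /= => gm gn.
  have -> : f m - f n = (f m - g) - (f n - g) by rewrite opprB subrKA.
  by rewrite rmorphD; apply: (le_trans (ler_normB _ _)); rewrite lerD ?ltW.
have evB m n b : `|keval (rkhs_fun (f m)) b - keval (rkhs_fun (f n)) b| <=
    ((m.+1%:R^-1 + n.+1%:R^-1) * knorm k b)%:C.
  have -> : keval (rkhs_fun (f m)) b - keval (rkhs_fun (f n)) b =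
      keval (rkhs_fun (f m - f n)) b.
    by rewrite -kevalB -rkhs_funB.
  apply: (le_trans (rkhs_norm_bound _ _)); rewrite rmorphM /=.
  by rewrite ler_wpM2r ?ler0c ?knorm_ge0//; exact: fB.
have evlim b : exists l, forall e : R, 0 < e -> exists n0, forall n, (n0 <= n)%N ->
     `|l - keval (rkhs_fun (f n)) b| <= e%:C.
  apply: complex_complete => e e0.
  have k1 : 0 < knorm k b + 1 by rewrite ltr_wpDl ?knorm_ge0.
  have e1 : 0 < e / (knorm k b + 1) / 2 by rewrite !divr_gt0.
  have [n0 hn] := invS_small e1; exists n0 => m n hm hn'.
  apply: (le_trans (evB m n b)); rewrite lecR.
  have h : m.+1%:R^-1 + n.+1%:R^-1 <= e / (knorm k b + 1).
    by rewrite [leRHS]splitr lerD ?hn.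
  apply: (le_trans (ler_wpM2r (knorm_ge0 _ _) h)).
  by rewrite -mulrA ger_pMr// mulrC ler_pdivrMr// mul1r lerDl.
have [l hl] := choice (fun x : X => evlim [:: (1, x)]).
have lB n : kbounded k (l - rkhs_fun (f n)) (2 * n.+1%:R^-1).
  split=> [|b]; first by rewrite mulr_ge0// invr_ge0.
  (* Pointwise convergence is uniform on the finitely many points of [b]; the constant is the sum of
     the moduli of its coefficients. It disappears when e tends to 0, leaving the uniform bound
     [evB]. *)
  have lev (e : R) : 0 < e -> exists n0, forall m, (n0 <= m)%N ->
      `|keval l b - keval (rkhs_fun (f m)) b| <= (e * \sum_(p <- b) complex.Re `|p.1|)%:C.
    move=> e0; elim: b => [|p b [n1 h1]].
      by exists 0%N => m _; rewrite /keval !big_nil subrr normr0 mulr0.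
    have [n2 h2] := hl p.2 e e0.
    exists (maxn n1 n2) => m; rewrite geq_max => /andP[/h1 {}h1 /h2 {}h2].
    rewrite /keval !big_cons opprD addrACA.
    apply: (le_trans (ler_normD _ _)); rewrite mulrDr [leRHS]rmorphD.
    apply: lerD h1; rewrite -mulrBr normrM norm_conjC.
    have [r [r0 rE]] := ge0_ex_realc (normr_ge0 p.1).
    rewrite rE /= rmorphM mulrC ler_wpM2r ?ler0c//.
    by move: h2; rewrite /keval big_seq1 /= conjC1 mul1r.
  rewrite kevalB.
  pose A : R := \sum_(p <- b) complex.Re `|p.1|.
  have A0 : 0 <= A.
    apply: sumr_ge0 => p _.
    by have [r [r0 ->]] := ge0_ex_realc (normr_ge0 p.1).
  apply: (@ler_epsc _ _ _ A) => // e e0.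
  have [n0 hn0] := lev e e0; pose m := maxn n0 n.
  have -> : keval l b - keval (rkhs_fun (f n)) b =
     (keval (rkhs_fun (f m)) b - keval (rkhs_fun (f n)) b) +
     (keval l b - keval (rkhs_fun (f m)) b) by ring.
  apply: (le_trans (ler_normD _ _)); apply: lerD; last first.
    by rewrite [A * e]mulrC; apply: hn0; rewrite leq_maxl.
  apply: (le_trans (evB m n b)); rewrite lecR ler_wpM2r ?knorm_ge0//.
  by rewrite mulr_natl mulr2n lerD2r lef_pV2 ?posrE// ler_nat ltnS leq_maxr.
have lnear : l \in knear_pred.
  apply/knear_predP => e e0.
  (* [l] is within e/2 of [f n0], which is within e/4 of a combination. *)
  have e4 : 0 < e / 4 by rewrite divr_gt0.
  have [n0 hn0] := invS_small e4.
  have [b hb] := rkhs_near (f n0) e4; exists b.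
  rewrite -(subrK (rkhs_fun (f n0)) l) -addrA.
  have [h1 h2] := kboundedD (lB n0) hb.
  split=> [|b']; first exact: ltW.
  apply: (le_trans (h2 b')); rewrite lecR ler_wpM2r ?knorm_ge0//.
  by move: (hn0 _ (leqnn n0)); set s := _^-1 => hs; lra.
apply/cvg_ex; exists (Rkhs lnear).
move=> A /nbhs_ballP[e /= e0 hA].
have [r [r0 rE]] := ge0_ex_realc (ltW e0).
have rp : 0 < r by rewrite -ltcR -rE.
have r4 : 0 < r / 4 by rewrite divr_gt0.
have [n hn] := invS_small r4.
apply: filterS (hf n) => g; rewrite -ball_normE /= => fg.
apply: hA; rewrite -ball_normE /=.
rewrite -(subrK (f n) (Rkhs lnear)) -addrA.
apply: (le_lt_trans (ler_normD _ _)).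
have h1 : `|Rkhs lnear - f n| <= (2 * n.+1%:R^-1)%:C.
  rewrite rkhs_normE lecR; apply: kopnorm_le.
  by rewrite rkhs_funB; exact: lB.
apply: (le_lt_trans (lerD h1 (ltW fg))).
rewrite rE -rmorphD ltcR; move: (hn _ (leqnn n)); set s := _^-1 => hs; lra.
Qed.

HB.instance Definition _ := Uniform_isComplete.Build rkhs rkhs_complete.

End RKHS.

(** * The inner product of a kernel space *)

Section RKHSDot.
Context {R : realType} {X : Type} (k : psd_kernel R X).
Implicit Types f g : rkhs k.

Definition rkhs_of (b : seq (R[i] * X)) : rkhs k :=
  Rkhs (introT (knear_predP k _) (knear_comb k b)).

Lemma rkhs_of_linear c b b' :
  rkhs_of (kscale c b ++ b') = c *: rkhs_of b + rkhs_of b'.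
Proof. by apply: val_inj; exact: kcomb_linear. Qed.

Lemma rkhs_of_norm b : `|rkhs_of b| ^+ 2 = knorm2 k b.
Proof. by rewrite rkhs_normE kopnorm_comb knorm2E -rmorphXn. Qed.

Lemma rkhs_of_approx f (e : R) : 0 < e -> exists b, `|f - rkhs_of b| <= e%:C.
Proof.
move=> e0; have [b hb] := rkhs_near f e0; exists b.
rewrite rkhs_normE lecR; apply: kopnorm_le.
by rewrite rkhs_funB.
Qed.

Lemma rkhs_of_cvg f : exists u : nat -> seq (R[i] * X),
  rkhs_of (u n) @[n --> \oo] --> f.
Proof.
have h n : exists b, `|f - rkhs_of b| <= (n.+1%:R^-1)%:C.
  by apply: rkhs_of_approx; rewrite invr_gt0.
have [u hu] := choice h; exists u.
apply/cvgrPdist_le => e e0.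
have [r [r0 rE]] := ge0_ex_realc (ltW e0).
have rp : 0 < r by rewrite -ltcR -rE.
have [n0 hn0] := invS_small rp.
exists n0 => // n /= hn; apply: (le_trans (hu n)).
by rewrite rE lecR hn0.
Qed.

(* Polarization; sesquilinearity then passes to the limit from combinations. *)
Definition rkhs_dot f g : R[i] :=
  4^-1 * (`|f + 1 *: g| ^+ 2 - `|f + (-1) *: g| ^+ 2 +
    'i%C * (`|f + 'i%C *: g| ^+ 2 - `|f + (- 'i%C) *: g| ^+ 2)).

Lemma conj_i : ('i%C : R[i])^* = - 'i%C.
Proof. by rewrite complexiE conjCi. Qed.

Lemma sqr_ic : ('i%C : R[i]) * 'i%C = -1.
Proof. by rewrite -expr2 complexiE sqrCi. Qed.

Lemma norm_ic : `|'i%C : R[i]| = 1.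
Proof. by rewrite complexiE normCi. Qed.

Lemma rkhs_dot_of b b' : rkhs_dot (rkhs_of b) (rkhs_of b') = keval (kcomb k b) b'.
Proof.
have h c : `|rkhs_of b + c *: rkhs_of b'| ^+ 2 = `|c| ^+ 2 * knorm2 k b' +
    c * keval (kcomb k b') b + c^* * keval (kcomb k b) b' + knorm2 k b.
  by rewrite addrC -rkhs_of_linear rkhs_of_norm knorm2_linear.
rewrite /rkhs_dot !h !normrN normr1 norm_ic.
rewrite !rmorphN rmorph1 /= conj_i.
set z := keval (kcomb k b') b; set w := keval (kcomb k b) b'.
set p := knorm2 k b; set q := knorm2 k b'.
transitivity (4^-1 * (2 * z + 2 * w + 2 * ('i%C * 'i%C) * (z - w))); first by ring.
by rewrite sqr_ic; field.
Qed.

Lemma rkhs_dot_cvg (u v : nat -> rkhs k) f g :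
  u n @[n --> \oo] --> f -> v n @[n --> \oo] --> g ->
  (rkhs_dot (u n) (v n) : R[i]^o) @[n --> \oo] --> (rkhs_dot f g : R[i]^o).
Proof.
move=> uf vg.
have h (w : nat -> rkhs k) x : w n @[n --> \oo] --> x ->
    (`|w n| ^+ 2 : R[i]^o) @[n --> \oo] --> (`|x| ^+ 2 : R[i]^o).
  by move=> wx; rewrite expr2; under eq_fun do rewrite expr2;
    apply: cvgM; apply: cvg_norm.
have hh c : (`|u n + c *: v n| ^+ 2 : R[i]^o) @[n --> \oo] -->
    (`|f + c *: g| ^+ 2 : R[i]^o).
  by apply: h; apply: cvgD => //; apply: cvgZl_tmp.
have hB c d : (`|u n + c *: v n| ^+ 2 - `|u n + d *: v n| ^+ 2 : R[i]^o)
    @[n --> \oo] --> (`|f + c *: g| ^+ 2 - `|f + d *: g| ^+ 2 : R[i]^o).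
  exact: (cvgB (hh c) (hh d)).
exact: (cvgMl_tmp (cvgD (hB 1 (-1)) (cvgMl_tmp (hB 'i%C (- 'i%C))))).
Qed.

Lemma rkhs_dot_linear c f f' g :
  rkhs_dot (c *: f + f') g = c * rkhs_dot f g + rkhs_dot f' g.
Proof.
have [u uf] := rkhs_of_cvg f; have [u' uf'] := rkhs_of_cvg f'.
have [v vg] := rkhs_of_cvg g.
have ll : (rkhs_of (kscale c (u n) ++ u' n)) @[n --> \oo] --> c *: f + f'.
  by under eq_fun do rewrite rkhs_of_linear; apply: cvgD => //; apply: cvgZl_tmp.
have h1 := rkhs_dot_cvg ll vg.
have h2 : (c * rkhs_dot (rkhs_of (u n)) (rkhs_of (v n)) +
    rkhs_dot (rkhs_of (u' n)) (rkhs_of (v n)) : R[i]^o) @[n --> \oo] -->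
    (c * rkhs_dot f g + rkhs_dot f' g : R[i]^o).
  by apply: cvgD; [apply: cvgMl_tmp|]; apply: rkhs_dot_cvg.
have e n : rkhs_dot (rkhs_of (kscale c (u n) ++ u' n)) (rkhs_of (v n)) =
    c * rkhs_dot (rkhs_of (u n)) (rkhs_of (v n)) +
    rkhs_dot (rkhs_of (u' n)) (rkhs_of (v n)).
  by rewrite !rkhs_dot_of kcomb_linear keval_linear.
have {}h1 : (rkhs_dot (rkhs_of (kscale c (u n) ++ u' n)) (rkhs_of (v n)) : R[i]^o)
    @[n --> \oo] --> (rkhs_dot (c *: f + f') g : R[i]^o) := h1.
rewrite (funext e) in h1.
exact: (cvg_unique (@norm_hausdorff R[i] R[i]^o) h1 h2).
Qed.

Lemma rkhs_dot_herm f g : rkhs_dot f g = (rkhs_dot g f)^*.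
Proof.
have nr (h : rkhs k) : (`|h| ^+ 2)^* = `|h| ^+ 2.
  by apply/CrealP; rewrite rpredX// normr_real.
have e1 : `|g + 1 *: f| = `|f + 1 *: g| by rewrite !scale1r addrC.
have e2 : `|g + (-1) *: f| = `|f + (-1) *: g| by rewrite !scaleN1r distrC.
have e3 : `|g + 'i%C *: f| = `|f + (- 'i%C) *: g|.
  rewrite -[RHS]mul1r -norm_ic -normrZ; congr `|_|.
  by rewrite scalerDr scalerA mulrN sqr_ic opprK scale1r addrC.
have e4 : `|g + (- 'i%C) *: f| = `|f + 'i%C *: g|.
  have ni : `|- 'i%C : R[i]| = 1 by rewrite normrN norm_ic.
  rewrite -[RHS]mul1r -ni -normrZ; congr `|_|.
  by rewrite scalerDr scalerA mulNr sqr_ic opprK scale1r addrC.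
rewrite /rkhs_dot e1 e2 e3 e4.
move: (nr (f + 1 *: g)) (nr (f + (-1) *: g)) (nr (f + 'i%C *: g))
  (nr (f + (- 'i%C) *: g)).
move: (`|f + 1 *: g| ^+ 2) (`|f + (-1) *: g| ^+ 2) (`|f + 'i%C *: g| ^+ 2)
  (`|f + (- 'i%C) *: g| ^+ 2) => a b c d ha hb hc hd.
rewrite rmorphM rmorphD rmorphM !rmorphB /= ha hb hc hd conj_i fmorphV rmorph_nat.
ring.
Qed.

Lemma rkhs_dotxx f : rkhs_dot f f = `|f| ^+ 2.
Proof.
have h c : `|f + c *: f| ^+ 2 = `|1 + c| ^+ 2 * `|f| ^+ 2.
  by rewrite -{1}[f]scale1r -scalerDl normrZ exprMn.
rewrite /rkhs_dot (h 1) (h (-1)) (h 'i%C) (h (- 'i%C)).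
move: (`|f| ^+ 2) => N.
have -> : `|1 + (- 'i%C) : R[i]| = `|1 + 'i%C|.
  by rewrite -norm_conjC rmorphD rmorphN rmorph1 /= conj_i opprK.
by rewrite !subrr normr0 mulr0 addr0 expr0n mul0r subr0 -mulr2n normr_nat; field.
Qed.

Lemma rkhs_dot_bilinear : bilinear_for *%R (Num.conj \; *%R) rkhs_dot.
Proof.
split=> [g c f f'|f c g g']; first exact (rkhs_dot_linear c f f' g).
have e : rkhs_dot f (c *: g + g') = c^* * rkhs_dot f g + rkhs_dot f g'.
  rewrite rkhs_dot_herm rkhs_dot_linear rmorphD rmorphM.
  by rewrite [rkhs_dot f g]rkhs_dot_herm [rkhs_dot f g']rkhs_dot_herm.
exact e.
Qed.

HB.instance Definition _ := @bilinear_isBilinear.Build R[i] (rkhs k) (rkhs k) R[i]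
  *%R (Num.conj \; *%R) rkhs_dot rkhs_dot_bilinear.

Lemma rkhs_dot_hermitian f g : rkhs_dot f g = (-1) ^+ false * (rkhs_dot g f)^*.
Proof. by rewrite expr0 mul1r rkhs_dot_herm. Qed.

HB.instance Definition _ := @isHermitianSesquilinear.Build R[i] (rkhs k) false
  Num.conj rkhs_dot rkhs_dot_hermitian.

Lemma rkhs_dot_gt0 f : f != 0 -> 0 < rkhs_dot f f.
Proof. by move=> f0; rewrite rkhs_dotxx exprn_gt0// normr_gt0. Qed.

HB.instance Definition _ := @isDotProduct.Build R[i] (rkhs k) rkhs_dot rkhs_dot_gt0.

Lemma rkhs_normE2 f : `|f| ^+ 2 = rkhs_dot f f.
Proof. by rewrite rkhs_dotxx. Qed.

Definition rkhs_hilbert : hilbert R :=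
  @Hilbert R (rkhs k) rkhs_dot rkhs_normE2.

End RKHSDot.

(* Moore-Aronszajn; every completion in the definition of the index arises from
   such a kernel. *)
Lemma kernel_hilbert (R : realType) (X : Type) (D : set X) (k : X -> X -> R[i]) :
  (forall m (c : 'I_m -> R[i]) (x : 'I_m -> X), (forall i, D (x i)) ->
    0 <= \sum_i \sum_j (c i)^* * c j * k (x i) (x j)) ->
  exists (H : hilbert R) (f : X -> H),
    (forall x y, D x -> D y -> dot (f x) (f y) = k x y) /\
    dense (lin_span (f @` D)).
Proof.
(* Positivity is given only on [D], so the kernel lives on the subtype; the map [f] is extended by 0
   outside [D]. *)
move=> kD; pose Y := {x : X | D x}.
pose kY (x y : Y) := k (sval x) (sval y).
have kY0 (b : seq (R[i] * Y)) :
    0 <= \sum_(p <- b) p.1^* * \sum_(q <- b) q.1 * kY p.2 q.2.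
  have := kD (size b) (fun i => (tnth (in_tuple b) i).1)
    (fun i => sval (tnth (in_tuple b) i).2) (fun i => svalP (tnth (in_tuple b) i).2).
  suff -> : \sum_(p <- b) p.1^* * \sum_(q <- b) q.1 * kY p.2 q.2 =
    \sum_i \sum_j ((tnth (in_tuple b) i).1)^* * (tnth (in_tuple b) j).1 *
      k (sval (tnth (in_tuple b) i).2) (sval (tnth (in_tuple b) j).2) by [].
  rewrite big_tnth; apply: eq_bigr => i _; rewrite big_tnth mulr_sumr.
  by apply: eq_bigr => j _; rewrite mulrA.
pose K := PsdKernel kY0.
exists (rkhs_hilbert K).
exists (fun x => if pselect (D x) is left Dx
  then rkhs_of K [:: (1, exist D x Dx)] else 0).
split.
  move=> x y Dx Dy; case: pselect => // Dx'; case: pselect => // Dy'.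
  rewrite /dot /= rkhs_dot_of /keval /kcomb !big_seq1 /= conjC1 !mul1r.
  by [].
apply: approx_dense => f e e0.
have [b hb] := rkhs_of_approx f e0; exists (rkhs_of K b) => //.
elim: b {hb} => [|p b IH].
  suff -> : rkhs_of K [::] = 0 by exact: lin_span0.
  by apply: val_inj; apply/funext => x; rewrite /= /kcomb big_nil.
have -> : rkhs_of K (p :: b) = p.1 *: rkhs_of K [:: (1, p.2)] + rkhs_of K b.
  rewrite -rkhs_of_linear /kscale /= mulr1; case: (p) => //.
apply: lin_span_linear => //; apply: lin_span_incl.
case: p => c [x Dx] /=; exists x => //.
case: pselect => // Dx'; congr (rkhs_of K [:: (_, exist _ _ _)]).
exact: Prop_irrelevance.
Qed.

(** * The GNS space of a trace *)

Section StarAlgebra.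
Context {R : realType}.
Implicit Types H K L : hilbert R.

Definition op_star_algebra H (M : set (H -> H)) : Prop :=
  [/\ (forall a, M a -> bounded_op a), M idfun,
    (forall (c : R[i]) a b, M a -> M b -> M (c *: a + b)),
    (forall a b, M a -> M b -> M (a \o b)) & forall a, M a -> M (adj a)].

Lemma comp_linearr H K L (c : R[i]) (T : K -> L) (a b : H -> K) : bounded_op T ->
  T \o (c *: a + b) = c *: (T \o a) + (T \o b).
Proof. by move=> bT; apply/funext => x; rewrite !fctE /= (bounded_linear bT). Qed.

Lemma commutant_star H (S : set (H -> H)) :
  (forall a, S a -> bounded_op a) -> (forall a, S a -> S (adj a)) ->
  op_star_algebra (commutant S).
Proof.
move=> bS aS; split=> [a []//|||a b [ba ca] [bb cb]|b [bb cb]].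
- by split=> //; exact: bounded_id.
- move=> c a b [ba ca] [bb cb]; split.
    by apply: boundedP_add => //; apply: boundedP_scale.
  by move=> s Ss; rewrite comp_linearr ?ca ?cb//; exact: bS.
- split=> [|s Ss]; first exact: bounded_comp.
  by rewrite compA ca// -compA cb.
- split=> [|s Ss]; first exact: bounded_adj.
  have := cb _ (aS _ Ss); have bs := bS _ Ss.
  move/(congr1 (@adj R H H)).
  rewrite (adj_comp (bounded_adj bs) bb) (adj_comp bb (bounded_adj bs)) (adjK bs).
  by move=> ->.
Qed.

Lemma comp_suml H K L n (c : 'I_n -> R[i]) (a : 'I_n -> K -> L) (b : H -> K) :
  (\sum_i c i *: a i) \o b = \sum_i c i *: (a i \o b).
Proof. by apply/funext => x; rewrite /= !fct_sumE. Qed.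

Lemma comp_sumr H K L n (c : 'I_n -> R[i]) (a : 'I_n -> H -> K) (b : K -> L) :
  bounded_op b -> b \o (\sum_i c i *: a i) = \sum_i c i *: (b \o a i).
Proof.
move=> bb; apply/funext => x; rewrite /= !fct_sumE bounded_sum//.
by apply: eq_bigr => i _; rewrite /= boundedZ.
Qed.

End StarAlgebra.

Section GNS.
Context {R : realType} {H : hilbert R} {M : set (H -> H)} {tau : (H -> H) -> R[i]}.
Context (Mstar : op_star_algebra M) (Mtau : normalized_trace M tau).
Implicit Types (a b : H -> H) (c : R[i]).

Let Mb a : M a -> bounded_op a. Proof. by case: Mstar => h _ _ _ _; apply: h. Qed.
Let M1 : M idfun. Proof. by case: Mstar. Qed.
Let ML c a b : M a -> M b -> M (c *: a + b).
Proof. by case: Mstar => _ _ h _ _; apply: h. Qed.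
Let MM a b : M a -> M b -> M (a \o b).
Proof. by case: Mstar => _ _ _ h _; apply: h. Qed.
Let MA a : M a -> M (adj a). Proof. by case: Mstar => _ _ _ _ h; apply: h. Qed.

Let tauL c a b : M a -> M b -> tau (c *: a + b) = c * tau a + tau b.
Proof. by case: Mtau => h _ _ _; apply: h. Qed.
Let tau_ge0 a : M a -> op_le 0 a -> 0 <= tau a.
Proof. by case: Mtau => _ h _ _; apply: h. Qed.
Let tauC a b : M a -> M b -> tau (a \o b) = tau (b \o a).
Proof. by case: Mtau => _ _ h _; apply: h. Qed.

Lemma star_algebra0 : M 0.
Proof. by have := ML (-1) M1 M1; rewrite scaleN1r addNr. Qed.

(** [F] is linear only on [M], so membership of the partial sums is carried along with the
    formula. *)
Lemma star_algebra_map_comb (V : lmodType R[i]) (F : (H -> H) -> V)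
    n (c : 'I_n -> R[i]) (a : 'I_n -> H -> H) :
  (forall (c : R[i]) a b, M a -> M b -> F (c *: a + b) = c *: F a + F b) ->
  (forall i, M (a i)) ->
  M (\sum_i c i *: a i) /\ F (\sum_i c i *: a i) = \sum_i c i *: F (a i).
Proof.
move=> FL Ma; apply: (big_rec2 (fun x y => M x /\ F x = y)).
  split; first exact: star_algebra0.
  by have := FL (-1) idfun idfun M1 M1; rewrite !scaleN1r !addNr.
by move=> i y x _ [Mx <-]; split; [exact: ML|rewrite FL].
Qed.

Lemma star_algebra_comb n (c : 'I_n -> R[i]) (a : 'I_n -> H -> H) :
  (forall i, M (a i)) -> M (\sum_i c i *: a i).
Proof. by move=> Ma; case: (star_algebra_map_comb (F := id) c _ Ma). Qed.

Lemma adj_comb n (c : 'I_n -> R[i]) (a : 'I_n -> H -> H) :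
  (forall i, M (a i)) -> adj (\sum_i c i *: a i) = \sum_i (c i)^* *: adj (a i).
Proof.
move=> Ma; suff [] : M (\sum_i c i *: a i) /\
  adj (\sum_i c i *: a i) = \sum_i (c i)^* *: adj (a i) by [].
apply: (big_rec2 (fun x y => M x /\ adj x = y)).
  split; first exact: star_algebra0.
  have := adj_linear (-1) (Mb M1) (Mb M1).
  by rewrite scaleN1r addNr rmorphN rmorph1 scaleN1r addNr.
by move=> i y x _ [Mx <-]; split; [exact: ML|rewrite adj_linear//; apply: Mb].
Qed.

(** The difference is the trace of b^* (C^2 - a^* a) b, a positive operator. *)
Lemma tau_bound a b (C : R) : 0 <= C -> M a -> M b ->
  (forall x, `|a x| <= C%:C * `|x|) ->
  tau (adj b \o (adj a \o a) \o b) <= (C ^+ 2)%:C * tau (adj b \o b).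
Proof.
move=> C0 Ma Mb' aC.
have M2 : M (adj b \o (adj a \o a) \o b) by do 3 (apply: (MM) => //); apply: MA.
have M3 : M (adj b \o b) by apply: MM => //; apply: MA.
have Ca0 x : 0 <= C%:C * `|x : H| by rewrite mulr_ge0 ?ler0c.
rewrite -subr_ge0 addrC -mulN1r.
(* The final [+ 0] gives both terms the shape [c *: a + b] in which linearity of [tau] is stated. *)
have -> : -1 * tau (adj b \o (adj a \o a) \o b) + (C ^+ 2)%:C * tau (adj b \o b)
    = tau (-1 *: (adj b \o (adj a \o a) \o b) + ((C ^+ 2)%:C *: (adj b \o b) + 0)).
  rewrite !tauL ?mulN1r//; last 2 first.
  - exact: star_algebra0.
  - by apply: ML => //; apply: star_algebra0.
  have -> : tau 0 = 0 by have := tauL (-1) M1 M1; rewrite scaleN1r addNr mulN1r addNr.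
  by rewrite addr0.
apply: tau_ge0; first by do 2 (apply: (ML) => //); apply: star_algebra0.
move=> x.
have e1 : dot x ((adj b \o (adj a \o a) \o b) x) = `|a (b x)| ^+ 2.
  by rewrite /= -!dot_adjr ?dotxx//; apply: Mb.
have e2 : dot x ((adj b \o b) x) = `|b x| ^+ 2.
  by rewrite /= -dot_adjr ?dotxx//; apply: Mb.
rewrite [(0 : H -> H) x](_ : _ = 0)// dot0r !fctE dotDr dotDr !dotZr e1 e2 dot0r.
rewrite addr0 mulN1r addrC subr_ge0 rmorphXn -exprMn.
by rewrite ler_sqr ?nnegrE.
Qed.

Section GNSSpace.
Context {L2 : hilbert R} {Lam : (H -> H) -> L2} (gL : gns M tau Lam).

Let LamL (c : R[i]) a b : M a -> M b -> Lam (c *: a + b) = c *: Lam a + Lam b.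
Proof. by case: gL => h _ _; apply: h. Qed.
Let Lam_dot a b : M a -> M b -> dot (Lam a) (Lam b) = tau (adj a \o b).
Proof. by case: gL => _ h _; apply: h. Qed.

Lemma dense_gns : dense (lin_span (Lam @` M)).
Proof.
by case: gL => _ _; apply: dense_sub => x; apply: lin_span_incl.
Qed.

Lemma gns_ext (K : hilbert R) (S T : L2 -> K) : bounded_op S -> bounded_op T ->
  (forall b, M b -> S (Lam b) = T (Lam b)) -> S = T.
Proof.
by move=> bS bT h; apply: (dense_span_op_ext bS bT dense_gns) => _ [b Mb' <-]; apply: h.
Qed.

Lemma gns_bounded_ext (g : (H -> H) -> (H -> H)) (C : R) : 0 <= C ->
  (forall (c : R[i]) a b, M a -> M b -> g (c *: a + b) = c *: g a + g b) ->
  (forall b, M b -> M (g b)) ->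
  (forall b, M b -> tau (adj (g b) \o g b) <= (C ^+ 2)%:C * tau (adj b \o b)) ->
  bounded_op (bounded_ext M Lam (Lam \o g)) /\
  forall b, M b -> bounded_ext M Lam (Lam \o g) (Lam b) = Lam (g b).
Proof.
move=> C0 gL' gM gC.
have [|T [bT hT]] := @bounded_ext_exists _ _ _ _ M Lam (Lam \o g) C C0 dense_gns.
  move=> m c x Mx /=.
  have [Ms e1] := star_algebra_map_comb c LamL Mx.
  have [_ e2] := star_algebra_map_comb (F := Lam \o g) c
    (fun (c : R[i]) a b Ma Mb =>
      etrans (congr1 Lam (gL' c a b Ma Mb)) (LamL c (gM _ Ma) (gM _ Mb))) Mx.
  rewrite -e1 -[X in `|X|]e2 /=; set s := \sum_i _ in Ms *.
  have p0 : 0 <= C%:C * `|Lam s| by rewrite mulr_ge0// ler0c.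
  rewrite -ler_sqr ?nnegrE// exprMn -!dotxx (Lam_dot (gM _ Ms) (gM _ Ms)) (Lam_dot Ms Ms).
  by apply: (le_trans (gC _ Ms)); rewrite rmorphXn.
by rewrite (bounded_ext_unique dense_gns bT hT).
Qed.

Lemma lmultP a : M a -> bounded_op (lmult M Lam a) /\
  forall b, M b -> lmult M Lam a (Lam b) = Lam (a \o b).
Proof.
move=> Ma; have [C [C0 hC]] := bounded_bound (Mb Ma).
apply: (@gns_bounded_ext (fun b => a \o b) C C0) => [c b b' _ _|b Mb'|b Mb'].
- by rewrite comp_linearr//; apply: Mb.
- exact: MM.
- rewrite (adj_comp (Mb Ma) (Mb Mb')).
  exact: tau_bound.
Qed.

(** The trace property turns |Lam (b a)|^2 into tau(b a a^* b^* ), so the bound for left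
    multiplication applies, with a^* acting on b^*. *)
Lemma rmultP a : M a -> bounded_op (rmult M Lam a) /\
  forall b, M b -> rmult M Lam a (Lam b) = Lam (b \o a).
Proof.
move=> Ma; have [C [C0 hC]] := bounded_bound (bounded_adj (Mb Ma)).
apply: (@gns_bounded_ext (fun b => b \o a) C C0) => [c b b' _ _|b Mb'|b Mb'].
- by [].
- exact: MM.
- rewrite (adj_comp (Mb Mb') (Mb Ma)).
  have -> : tau ((adj a \o adj b) \o (b \o a)) =
      tau (adj (adj b) \o (adj (adj a) \o adj a) \o adj b).
    rewrite (adjK (Mb Mb')) (adjK (Mb Ma)) tauC//; last 2 first.
    + by apply: MM; apply: MA.
    + exact: MM.
  apply: (le_trans (tau_bound C0 (MA Ma) (MA Mb') hC)).
  by rewrite (adjK (Mb Mb')) tauC//; apply: MA.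
Qed.

Lemma bounded_lmult a : M a -> bounded_op (lmult M Lam a).
Proof. by case/lmultP. Qed.

Lemma lmultE a b : M a -> M b -> lmult M Lam a (Lam b) = Lam (a \o b).
Proof. by case/lmultP => _; apply. Qed.

Lemma lmult_comp a b : M a -> M b ->
  lmult M Lam (a \o b) = lmult M Lam a \o lmult M Lam b.
Proof.
move=> Ma Mb'; apply: gns_ext.
- by apply: bounded_lmult; apply: MM.
- by apply: bounded_comp; apply: bounded_lmult.
- by move=> d Md; rewrite /= !lmultE//; apply: MM.
Qed.

Lemma lmult_linear c a b : M a -> M b ->
  lmult M Lam (c *: a + b) = c *: lmult M Lam a + lmult M Lam b.
Proof.
move=> Ma Mb'; apply: gns_ext.
- by apply: bounded_lmult; apply: ML.
- by apply: boundedP_add; [apply: boundedP_scale|]; apply: bounded_lmult.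
- move=> d Md; rewrite !fctE (lmultE (ML c Ma Mb') Md) (lmultE Ma Md) (lmultE Mb' Md).
  by rewrite -LamL//; apply: MM.
Qed.

Lemma lmult_id : lmult M Lam idfun = idfun.
Proof.
apply: gns_ext; [exact: bounded_lmult|exact: bounded_id|].
by move=> d Md; rewrite lmultE.
Qed.

Lemma lmult_scalar c : lmult M Lam (c *: idfun) = c *: idfun.
Proof.
have := lmult_linear c M1 star_algebra0.
have l0 : lmult M Lam 0 = 0.
  have := lmult_linear (-1) M1 M1.
  by rewrite scaleN1r addNr scaleN1r addNr.
by rewrite l0 !addr0 lmult_id.
Qed.

Lemma rmult_scalar c : rmult M Lam (c *: idfun) = c *: idfun.
Proof.
have Mc : M (c *: idfun) by rewrite -[_ *: _]addr0; apply: ML => //; exact: star_algebra0.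
have [br hr] := rmultP Mc.
apply: gns_ext => //; first by apply: boundedP_scale; exact: bounded_id.
move=> b Mb'; rewrite hr//.
have -> : b \o (c *: idfun) = c *: b + 0.
  by apply/funext => x; rewrite !fctE /= addr0 (boundedZ _ _ (Mb Mb')).
rewrite LamL//; last exact: star_algebra0.
have -> : Lam 0 = 0.
  by have := LamL (-1) M1 M1; rewrite !scaleN1r !addNr.
by rewrite addr0.
Qed.

Lemma lmult_adj a : M a -> adj (lmult M Lam a) = lmult M Lam (adj a).
Proof.
move=> Ma; apply: gns_ext.
- by apply: bounded_adj; apply: bounded_lmult.
- by apply: bounded_lmult; apply: MA.
- move=> b Mb'; apply: (dense_span_dot_ext dense_gns) => _ [d Md <-].
  rewrite -dot_adjr; last exact: bounded_lmult.
  rewrite !lmultE//; last exact: MA.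
  rewrite !Lam_dot//; [|apply: MM => //; exact: MA|exact: MM].
  by rewrite (adj_comp (Mb Ma) (Mb Md)).
Qed.

Local Notation Om := (Lam idfun).

Lemma gns_unit_norm : dot Om Om = 1.
Proof.
rewrite Lam_dot// adj_id; have -> : idfun \o idfun = idfun :> (H -> H) by [].
by case: Mtau.
Qed.

Lemma rmult_unit a : M a -> dot Om (rmult M Lam a Om) = tau a.
Proof.
move=> Ma; have [_ ->] := rmultP Ma => //.
by rewrite Lam_dot ?adj_id//; apply: MM.
Qed.

(** Against the dense vectors Lam a, the inner product with S Om equals that of S^* Om with Lam (a^*
    ), because S commutes with a^*; and Lam (a^* ) has the norm of Lam a because tau is a trace. *)
Lemma commuting_trace_vector_le (S : L2 -> L2) : bounded_op S ->
  (forall a, M a -> S \o lmult M Lam a = lmult M Lam a \o S) ->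
  `|S Om| <= `|adj S Om|.
Proof.
move=> bS cS; case: gL => _ _ dL.
apply: (dense_dot_le (normr_ge0 _) dL) => _ [a Ma <-].
have aE : Lam a = lmult M Lam a Om by rewrite lmultE.
have h : dot (Lam a) (S Om) = dot (adj S Om) (Lam (adj a)).
  rewrite {1}aE dot_adjr; last exact: bounded_lmult.
  rewrite lmult_adj//; have := congr1 (fun F => F Om) (cS _ (MA Ma)).
  by rewrite /= => <-; rewrite dot_adjl// lmultE//; apply: MA.
rewrite h; apply: (le_trans (hilbert_cauchy_schwarz _ _)).
suff -> : `|Lam (adj a)| = `|Lam a| by [].
apply/eqP; rewrite -(@eqrXn2 _ 2)// -!dotxx (Lam_dot (MA Ma) (MA Ma)) (Lam_dot Ma Ma).
by rewrite (adjK (Mb Ma)) tauC//; exact: MA.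
Qed.

(* [Om] is a trace vector for the commutant of the left multiplications. *)
Lemma commuting_trace_vector (S : L2 -> L2) : bounded_op S ->
  (forall a, M a -> S \o lmult M Lam a = lmult M Lam a \o S) ->
  `|adj S Om| = `|S Om|.
Proof.
move=> bS cS; apply/eqP; rewrite eq_le commuting_trace_vector_le// andbT.
rewrite -{2}(adjK bS); apply: commuting_trace_vector_le; first exact: bounded_adj.
move=> a Ma; have := congr1 (@adj R L2 L2) (cS _ (MA Ma)).
have bl := bounded_lmult (MA Ma).
rewrite (adj_comp bS bl) (adj_comp bl bS) lmult_adj; last exact: MA.
by rewrite (adjK (Mb Ma)) => ->.
Qed.

End GNSSpace.

Lemma gns_exists : exists (L2 : hilbert R) (Lam : (H -> H) -> L2), gns M tau Lam.
Proof.
have [|L2 [Lam [hL dL]]] := @kernel_hilbert R (H -> H) M (fun a b => tau (adj a \o b)).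
  move=> m c x Mx.
  have Ms := star_algebra_comb c Mx; set s := \sum_i _ in Ms.
  suff -> : \sum_i \sum_j (c i)^* * c j * tau (adj (x i) \o x j) = tau (adj s \o s).
    apply: tau_ge0; first by apply: MM => //; apply: MA.
    move=> v; rewrite [(0 : H -> H) v](_ : _ = 0)// dot0r /= -dot_adjr; last exact: Mb.
    exact: dotxx_ge0.
  rewrite {1}/s adj_comb// comp_suml.
  have tL (d : R[i]) a b : M a -> M b -> (tau : (H -> H) -> R[i]^o) (d *: a + b) =
    d *: (tau a : R[i]^o) + tau b by exact: tauL.
  have Mas i : M (adj (x i) \o s) by apply: MM => //; apply: MA.
  have [_ ->] := star_algebra_map_comb (V := R[i]^o) (F := tau) (fun i => (c i)^*) tL Mas.
  apply: eq_bigr => i _; rewrite /s comp_sumr; last by apply: bounded_adj; apply: Mb.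
  have Maj j : M (adj (x i) \o x j) by apply: MM => //; apply: MA.
  have [_ ->] := star_algebra_map_comb (V := R[i]^o) (F := tau) c tL Maj.
  by rewrite scaler_sumr; apply: eq_bigr => j _; exact: esym (mulrA _ _ _).
(* The kernel construction yields a bare map; linearity holds because both sides have the same inner
   products with a total set. The image of [M] is then a subspace, so density of its span is density
   of the image. *)
have LamL (c : R[i]) a b : M a -> M b -> Lam (c *: a + b) = c *: Lam a + Lam b.
  move=> Ma Mb'; apply: (dense_span_dot_ext dL) => _ [d Md <-].
  rewrite dotDr dotZr !hL//; last exact: ML.
  rewrite comp_linearr ?tauL//; [| |by apply: bounded_adj; apply: Mb];
    by apply: MM => //; apply: MA.
exists L2, Lam; split=> //.
apply: dense_sub dL; apply: lin_span_min => [|c _ _ [a Ma <-] [b Mb' <-]|//].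
  exists 0; first exact: star_algebra0.
  by have := LamL (-1) idfun idfun M1 M1; rewrite !scaleN1r !addNr.
by exists (c *: a + b); [exact: ML|exact: LamL].
Qed.

End GNS.

(** * Tensor products *)

Section Compress.
Context {R : realType}.
Implicit Types H K : hilbert R.

Lemma tensor_dense (V : lmodType R[i]) (W : hilbert R) (E : set V) form
    (K : hilbert R) (iota : V -> W -> K) :
  tensor_completion E form iota ->
  dense (lin_span ((fun x => iota x.1 x.2) @` (E `*` [set: W]))).
Proof.
case=> _ _ _; apply: dense_sub; apply: lin_span_sub => _ [v [w [Ev ->]]].
by apply: lin_span_incl; exists (v, w).
Qed.

(** With V = (U_k)_k as one operator from K to H^n, this is V^* D V, where D acts as S on each
    summand. *)
Definition compress H K n (U : 'I_n -> K -> H) (S : H -> H) : K -> K :=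
  \sum_k (adj (U k) \o S \o U k).

Lemma compressE H K n (U : 'I_n -> K -> H) (S : H -> H) v :
  compress U S v = \sum_k adj (U k) (S (U k v)).
Proof. by rewrite /compress fct_sumE. Qed.

Lemma bounded_compress H K n (U : 'I_n -> K -> H) (S : H -> H) :
  (forall k, bounded_op (U k)) -> bounded_op S -> bounded_op (compress U S).
Proof.
move=> bU bS; apply: boundedP_sum => k _; apply: bounded_comp => //.
by apply: bounded_comp => //; apply: bounded_adj.
Qed.

Lemma adj_compress H K n (U : 'I_n -> K -> H) (S : H -> H) :
  (forall k, bounded_op (U k)) -> bounded_op S ->
  adj (compress U S) = compress U (adj S).
Proof.
move=> bU bS; apply: adj_unique; first exact: bounded_compress.
move=> x y; rewrite !compressE dot_suml dot_sumr; apply: eq_bigr => k _.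
by rewrite dot_adjl// !dot_adjr.
Qed.

Section Resolution.
Context {V : lmodType R[i]} {W H K : hilbert R} {E : set V}.
Context {form : V -> W -> V -> W -> R[i]} {iota : V -> W -> K}.
Context {n : nat} {U : 'I_n -> K -> H}.
Context (tc : tensor_completion E form iota) (bU : forall k, bounded_op (U k)).
Context (sU : forall v, \sum_k adj (U k) (U k v) = v).

Lemma tensor_op_unique (f : V -> V) (g : W -> W) T : bounded_op T ->
  (forall b h, E b -> T (iota b h) = iota (f b) (g h)) ->
  tensor_op E iota f g = T.
Proof.
move=> bT hT; apply: (bounded_ext_unique (tensor_dense tc)) => //.
by move=> [b h] [/= Eb _]; apply: hT.
Qed.

Lemma tensor_ext (L : hilbert R) (S T : K -> L) : bounded_op S -> bounded_op T ->
  (forall b h, E b -> S (iota b h) = T (iota b h)) -> S = T.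
Proof.
move=> bS bT hST; apply: (dense_span_op_ext bS bT (tensor_dense tc)).
by move=> _ [[b h] [/= Eb _] <-]; apply: hST.
Qed.

Lemma compress_tensor (f : V -> V) (g : W -> W) S b h : E b ->
  (forall b h k, E b -> S (U k (iota b h)) = U k (iota (f b) (g h))) ->
  compress U S (iota b h) = iota (f b) (g h).
Proof.
by move=> Eb hS; rewrite compressE -[RHS]sU; apply: eq_bigr => k _; rewrite hS.
Qed.

Lemma norm_resolution v : \sum_k `|U k v| ^+ 2 = `|v| ^+ 2.
Proof.
rewrite -dotxx -[in X in dot _ X](sU v) dot_sumr; apply: eq_bigr => k _.
by rewrite -dot_adjr ?dotxx.
Qed.

(** An operator prescribed on elementary tensors exists and is bounded as soon as it acts on every
    component through one bounded operator [S]. *)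
Lemma tensor_op_compress (f : V -> V) (g : W -> W) S : bounded_op S ->
  (forall b h k, E b -> S (U k (iota b h)) = U k (iota (f b) (g h))) ->
  tensor_op E iota f g = compress U S.
Proof.
move=> bS hS; apply: tensor_op_unique; first exact: bounded_compress.
by move=> b h Eb; apply: compress_tensor.
Qed.

(** The range of V = (U_k)_k is invariant under S acting on each summand, so that compressing loses
    nothing. *)
Lemma compress_intertwine (f : V -> V) (g : W -> W) S k : bounded_op S ->
  (forall b h k, E b -> S (U k (iota b h)) = U k (iota (f b) (g h))) ->
  U k \o compress U S = S \o U k.
Proof.
move=> bS hS; apply: tensor_ext.
- by apply: bounded_comp => //; apply: bounded_compress.
- exact: bounded_comp.
by move=> b h Eb /=; rewrite hS// (compress_tensor _ Eb hS).
Qed.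

Lemma compress_intertwine_adj S k : bounded_op S ->
  U k \o compress U (adj S) = adj S \o U k ->
  compress U S \o adj (U k) = adj (U k) \o S.
Proof.
move=> bS h; have bS' := bounded_adj bS.
have := congr1 (@adj R K H) h.
rewrite (adj_comp (bU k) (bounded_compress bU bS')) adj_compress// adjK//.
by rewrite (adj_comp bS' (bU k)) adjK.
Qed.

End Resolution.

End Compress.

(** * Idempotent matrices *)

Lemma idempotent_base (F : fieldType) n (C : 'M[F]_n) : C *m C = C ->
  row_base C *m col_base C = 1%:M.
Proof.
move=> CC; apply: (row_full_inj (col_base_full C)).
apply: (row_free_inj (row_base_free C)).
by rewrite mulmx1 mulmxA mulmx_base -mulmxA mulmx_base.
Qed.

(** For the row vector t the hypotheses read t C = t, and C v = 0 whenever t v = 0. With C = A B and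
    B A = 1 the entries of t A form a basis: t = (t A) B shows that they span, and t A c = 0 gives A
    c = C A c = 0, hence c = 0. *)
Lemma idempotent_has_dim (R : realType) (V : lmodType R[i]) n (t : 'I_n -> V)
    (C : 'M[R[i]]_n) : C *m C = C ->
  (forall j, t j = \sum_k C k j *: t k) ->
  (forall v : 'cV[R[i]]_n, \sum_k v k 0 *: t k = 0 -> C *m v = 0) ->
  has_dim (lin_span (range t)) (\rank C).
Proof.
move=> CC tC rel.
have [A [B [CE BA]]] : exists (A : 'M[R[i]]_(n, \rank C))
    (B : 'M[R[i]]_(\rank C, n)), C = A *m B /\ B *m A = 1%:M.
  by exists (col_base C), (row_base C); rewrite mulmx_base idempotent_base.
exists (fun i => \sum_k A k i *: t k); split.
  move=> c hc i.
  pose v : 'cV[R[i]]_n := A *m (\col_i c i).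
  have : C *m v = 0.
    apply: rel; rewrite -{}[RHS]hc.
    under [RHS]eq_bigr do rewrite scaler_sumr.
    rewrite exchange_big; apply: eq_bigr => k _; rewrite mxE scaler_suml.
    by apply: eq_bigr => j _; rewrite mxE scalerA mulrC.
  rewrite {1}CE /v -mulmxA (mulmxA B) BA mul1mx => h.
  have := congr1 (mulmx B) h; rewrite mulmxA BA mul1mx mulmx0.
  by move/matrixP/(_ i 0); rewrite !mxE.
have tb j : t j = \sum_i B i j *: \sum_k A k i *: t k.
  rewrite {1}tC; under [RHS]eq_bigr do rewrite scaler_sumr.
  rewrite exchange_big; apply: eq_bigr => k _.
  rewrite {1}CE mxE scaler_suml.
  by apply: eq_bigr => i _; rewrite scalerA mulrC.
apply/seteqP; split; apply: lin_span_sub => _ [j _ <-].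
  by apply: lin_span_sum => k _; apply: lin_spanZ; apply: lin_span_incl; exists k.
rewrite tb.
by apply: lin_span_sum => k _; apply: lin_spanZ; apply: lin_span_incl; exists k.
Qed.

Lemma idempotent_trace (F : fieldType) n (C : 'M[F]_n) : C *m C = C ->
  \tr C = (\rank C)%:R.
Proof.
by move=> CC; rewrite -{1}(mulmx_base C) mxtrace_mulC idempotent_base// mxtrace1.
Qed.

(** * Schur products and the existence of completed tensor products *)

Section TensorExistence.
Context {R : realType}.

(* Schur product theorem: expanding each [p.2] along [p0.2] splits off a square
   and leaves vectors orthogonal to [p0.2]. *)
Lemma schur_ge0 (W : lmodType R[i]) (K : hilbert R) (B : W -> W -> R[i])
    (s : seq (W * K)) :
  (forall c x y z, B z (c *: x + y) = c * B z x + B z y) ->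
  (forall x y, B x y = (B y x)^*) -> (forall x, 0 <= B x x) ->
  0 <= \sum_(p <- s) \sum_(q <- s) B p.1 q.1 * dot p.2 q.2.
Proof.
move=> BL BH B0.
have Bsumr z (r : seq (W * K)) (f : W * K -> R[i]) :
    B z (\sum_(q <- r) f q *: q.1) = \sum_(q <- r) f q * B z q.1.
  elim: r => [|q r IH]; last by rewrite !big_cons BL IH.
  rewrite !big_nil; have := BL (-1) 0 0 z.
  by rewrite scaleN1r addNr mulN1r addNr.
have Bsuml z (r : seq (W * K)) (f : W * K -> R[i]) :
    B (\sum_(q <- r) f q *: q.1) z = \sum_(q <- r) (f q)^* * B q.1 z.
  rewrite BH Bsumr rmorph_sum; apply: eq_bigr => q _.
  by rewrite rmorphM /= -BH.
elim: {s}(size s) {-2}s (leqnn (size s)) => [|m IH] [|p0 s] //= hs;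
  rewrite ?big_nil//.
(* If k0 = 0 the quotient is 0 by convention, and the remainders are still orthogonal to k0. *)
pose k0 := p0.2; pose al (p : W * K) : R[i] := dot k0 p.2 / dot k0 k0.
have [rest [restE orth]] : exists rest : W * K -> K,
    (forall p, p.2 = al p *: k0 + rest p) /\ forall p, dot k0 (rest p) = 0.
  exists (fun p => p.2 - al p *: k0); split=> p; first by rewrite addrC subrK.
  rewrite dotBr dotZr /al; have [->|nz] := eqVneq k0 0.
    by rewrite !dot0l mul0r mul0r subrr.
  rewrite divfK ?subrr//; apply: contraNN nz => /eqP/dotxx_eq0 ->.
  exact: eqxx.
have orth' p : dot (rest p) k0 = 0 by rewrite dotC orth rmorph0.
(* The head of the list contributes nothing to the sum over the remainders, so the induction applies
   to the tail. *)
have rest0 : rest p0 = 0.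
  apply: dotxx_eq0; have -> : rest p0 = k0 - al p0 *: k0.
    by rewrite {1}/k0 (restE p0) addrC addKr.
  rewrite dotBr dotZr.
  suff -> : dot (k0 - al p0 *: k0) k0 = 0 by rewrite mulr0 subr0.
  have := orth' p0; rewrite (_ : rest p0 = k0 - al p0 *: k0)//.
  by rewrite {1}/k0 (restE p0) addrC addKr.
have split_dot p q : dot p.2 q.2 =
    (al p)^* * al q * dot k0 k0 + dot (rest p) (rest q).
  rewrite (restE p) (restE q) !dotDl !dotDr !dotZl !dotZr orth orth' !mulr0.
  by rewrite addr0 add0r mulrA.
pose r := p0 :: s; pose pr (p : W * K) := (p.1, rest p).
pose y := \sum_(p <- r) al p *: p.1.
have -> : \sum_(p <- r) \sum_(q <- r) B p.1 q.1 * dot p.2 q.2 =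
    dot k0 k0 * B y y +
    \sum_(p <- [seq pr p | p <- s]) \sum_(q <- [seq pr p | p <- s])
      B p.1 q.1 * dot p.2 q.2.
  transitivity (dot k0 k0 * B y y +
      \sum_(p <- r) \sum_(q <- r) B p.1 q.1 * dot (rest p) (rest q)).
    rewrite {1}/y Bsuml mulr_sumr -big_split; apply: eq_bigr => p _ /=.
    rewrite /y Bsumr !mulr_sumr -big_split; apply: eq_bigr => q _ /=.
    by rewrite split_dot; ring.
  congr (_ + _); rewrite big_cons [X in X + _]big1 ?add0r; last first.
    by move=> q _; rewrite rest0 dot0l mulr0.
  rewrite big_map; apply: eq_bigr => p _.
  by rewrite big_cons rest0 dot0r mulr0 add0r big_map.
rewrite addr_ge0 ?mulr_ge0 ?dotxx_ge0//.
by apply: IH; rewrite size_map.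
Qed.

Lemma schur_ord_ge0 (W : lmodType R[i]) (K : hilbert R) (B : W -> W -> R[i])
    m (c : 'I_m -> R[i]) (x : 'I_m -> W) (k : 'I_m -> K) :
  (forall c x y z, B z (c *: x + y) = c * B z x + B z y) ->
  (forall x y, B x y = (B y x)^*) -> (forall x, 0 <= B x x) ->
  0 <= \sum_i \sum_j (c i)^* * c j * (B (x i) (x j) * dot (k i) (k j)).
Proof.
move=> BL BH B0.
have := @schur_ge0 W K B [seq (x i, c i *: k i) | i <- enum 'I_m] BL BH B0.
rewrite big_map big_enum; congr (0 <= _); apply: eq_bigr => i _.
rewrite big_map big_enum; apply: eq_bigr => j _ /=.
by rewrite dotZl dotZr; ring.
Qed.

(** The Hilbert space is that of the kernel [form] on pairs (v, w). Bilinearity of [iota] follows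
    from linearity of [form] in its second pair, since inner products with generators determine a
    vector. *)
Lemma tensor_completion_exists (V : lmodType R[i]) (W : hilbert R) (E : set V)
    (form : V -> W -> V -> W -> R[i]) :
  (forall c v v', E v -> E v' -> E (c *: v + v')) ->
  (forall c v v' v0 w w0, E v -> E v' -> E v0 ->
    form v0 w0 (c *: v + v') w = c * form v0 w0 v w + form v0 w0 v' w) ->
  (forall c v v0 w w' w0, E v -> E v0 ->
    form v0 w0 v (c *: w + w') = c * form v0 w0 v w + form v0 w0 v w') ->
  (forall m (c : 'I_m -> R[i]) (v : 'I_m -> V) (w : 'I_m -> W),
    (forall i, E (v i)) ->
    0 <= \sum_i \sum_j (c i)^* * c j * form (v i) (w i) (v j) (w j)) ->
  exists (K : hilbert R) (iota : V -> W -> K), tensor_completion E form iota.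
Proof.
move=> EL fV fW f0.
have [|K [f [hf df]]] := @kernel_hilbert R (V * W) (E `*` [set: W])
  (fun x y => form x.1 x.2 y.1 y.2).
  by move=> m c x Dx; apply: f0 => i; case: (Dx i).
exists K, (fun v w => f (v, w)); split.
- move=> c a b h Na Nb'; apply: (dense_span_dot_ext df) => _ [[d k] [/= Nd _] <-].
  by rewrite dotDr dotZr !hf//= ?fV//; split=> //; exact: EL.
- move=> c a h h' Na; apply: (dense_span_dot_ext df) => _ [[d k] [/= Nd _] <-].
  by rewrite dotDr dotZr !hf//= fW.
- by move=> a1 h1 a2 h2 Na1 Na2; rewrite hf.
- apply: dense_sub df; apply: lin_span_sub => _ [[a h] [/= Na _] <-].
  by apply: lin_span_incl; exists a, h.
Qed.

Lemma components_ge0 (X : Type) (H : hilbert R) n (g : 'I_n -> X -> H)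
    (k : X -> X -> R[i]) m (c : 'I_m -> R[i]) (x : 'I_m -> X) :
  (forall i j, k (x i) (x j) = \sum_l dot (g l (x i)) (g l (x j))) ->
  0 <= \sum_i \sum_j (c i)^* * c j * k (x i) (x j).
Proof.
move=> hk.
suff -> : \sum_i \sum_j (c i)^* * c j * k (x i) (x j) =
    \sum_l dot (\sum_i c i *: g l (x i)) (\sum_i c i *: g l (x i)).
  by apply: sumr_ge0 => l _; exact: dotxx_ge0.
under [RHS]eq_bigr do rewrite dot_suml.
rewrite [RHS]exchange_big; apply: eq_bigr => i _ /=.
under [RHS]eq_bigr do rewrite dot_sumr.
rewrite [RHS]exchange_big; apply: eq_bigr => j _ /=.
by rewrite hk mulr_sumr; apply: eq_bigr => l _; rewrite dotZl dotZr mulrA.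
Qed.

End TensorExistence.

(** * Tensor products of two Hilbert spaces *)

Section HilbertTensor.
Context {R : realType} {W K0 T : hilbert R} {iota : W -> K0 -> T}.

Local Notation hform := (fun (x1 : W) (k1 : K0) (x2 : W) (k2 : K0) =>
  dot x1 x2 * dot k1 k2).

Lemma hilbert_tensor_exists :
  exists (T' : hilbert R) (iota' : W -> K0 -> T'), tensor_completion setT hform iota'.
Proof.
apply: tensor_completion_exists => //.
- by move=> c v v' v0 w w0 _ _ _; rewrite dotDr dotZr mulrDl mulrA.
- by move=> c v v0 w w' w0 _ _; rewrite dotDr dotZr mulrDr mulrCA.
- move=> m c v w _; apply: (schur_ord_ge0 (B := @dot R W)) => [d x y z|x y|x].
  + by rewrite dotDr dotZr.
  + exact: dotC.
  + exact: dotxx_ge0.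
Qed.

Context (tc : tensor_completion setT hform iota).

Let iotaDl c x y k : iota (c *: x + y) k = c *: iota x k + iota y k.
Proof. by case: tc => h _ _ _; apply: h. Qed.
Let iotaDr c x k l : iota x (c *: k + l) = c *: iota x k + iota x l.
Proof. by case: tc => _ h _ _; apply: h. Qed.
Let iota_dot x k y l : dot (iota x k) (iota y l) = dot x y * dot k l.
Proof. by case: tc => _ _ h _; apply: h. Qed.

(** If C bounds A, the form B(v, w) = C^2 <v, w> - <A v, A w> is positive; its Schur product with
    the inner product of the second factor is the estimate that bounds A ⊗ 1 by C. *)
Lemma tensor_op_left (A : W -> W) : bounded_op A ->
  bounded_op (tensor_op setT iota A idfun) /\
  forall x k, tensor_op setT iota A idfun (iota x k) = iota (A x) k.
Proof.
move=> bA; have [C [C0 hC]] := bounded_bound bA.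
have [|S [bS hS]] := @bounded_ext_exists R (W * K0) T T ([set: W] `*` [set: K0])
    (fun x => iota x.1 x.2) (fun x => iota (A x.1) x.2) C C0 (tensor_dense tc).
  move=> m c x _.
  have p0 : 0 <= C%:C * `|\sum_k c k *: iota (x k).1 (x k).2|.
    by rewrite mulr_ge0// ler0c.
  rewrite -ler_sqr ?nnegrE// exprMn -!dotxx -subr_ge0.
  pose B (v w : W) := C%:C ^+ 2 * dot v w - dot (A v) (A w).
  have := schur_ord_ge0 (B := B) c (fun i => (x i).1) (fun i => (x i).2).
  have ee (g : W * K0 -> W) : dot (\sum_k c k *: iota (g (x k)) (x k).2)
        (\sum_k c k *: iota (g (x k)) (x k).2) =
      \sum_i \sum_j (c i)^* * c j * (dot (g (x i)) (g (x j)) * dot (x i).2 (x j).2).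
    rewrite dot_suml; apply: eq_bigr => i _; rewrite dot_sumr; apply: eq_bigr => j _.
    by rewrite dotZl dotZr iota_dot; ring.
  rewrite (ee fst) (ee (fun p => A p.1)) mulr_sumr -sumrB.
  set s1 := \sum_i _; set s2 := \sum_i _.
  have -> : s1 = s2.
    apply: eq_bigr => i _; rewrite mulr_sumr -sumrB; apply: eq_bigr => j _.
    by rewrite /B; ring.
  apply => [d v w z|v w|v]; rewrite /B.
  - by rewrite (bounded_linear bA) !dotDr !dotZr; ring.
  - rewrite rmorphB rmorphM /= -!dotC; congr (_ * _ - _).
    by rewrite rmorphXn /= conj_realc.
  - by rewrite !dotxx -exprMn subr_ge0 ler_sqr ?nnegrE ?mulr_ge0 ?ler0c.
have -> : tensor_op setT iota A idfun = S.
  by apply: (tensor_op_unique tc bS) => v w _; apply: (hS (v, w)).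
by split=> // x k; apply: (hS (x, k)).
Qed.

Lemma tensor_op_left_adj (A : W -> W) : bounded_op A ->
  adj (tensor_op setT iota A idfun) = tensor_op setT iota (adj A) idfun.
Proof.
move=> bA; have [bL hL] := tensor_op_left bA.
have [bL' hL'] := tensor_op_left (bounded_adj bA).
apply: (tensor_ext tc) => //; first exact: bounded_adj.
move=> x k _; apply: (dense_span_dot_ext (tensor_dense tc)) => _ [[y l] _ <-] /=.
by rewrite -dot_adjr// hL hL' !iota_dot dot_adjr.
Qed.

Lemma bounded_slice k : bounded_op (fun x => iota x k).
Proof.
apply/bounded_opP; split; first by move=> c x y; rewrite iotaDl.
have [r [r0 rE]] := ge0_ex_realc (normr_ge0 k).
exists r; split=> // x; rewrite -ler_sqr ?nnegrE ?mulr_ge0 ?ler0c//.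
by rewrite exprMn -!dotxx iota_dot [dot k k]dotxx rE mulrC.
Qed.

Lemma slice_intertwine (A : W -> W) k : bounded_op A ->
  adj (fun x => iota x k) \o tensor_op setT iota A idfun =
  A \o adj (fun x => iota x k).
Proof.
move=> bA; have [bL hL] := tensor_op_left (bounded_adj bA).
have h : tensor_op setT iota (adj A) idfun \o (fun x => iota x k) =
    (fun x => iota x k) \o adj A by apply/funext => x /=; rewrite hL.
have := congr1 (@adj R W T) h; have bs := bounded_slice k.
rewrite (adj_comp bL bs) (adj_comp bs (bounded_adj bA)).
by rewrite tensor_op_left_adj ?adjK//; exact: bounded_adj.
Qed.

(** * Parseval's formula along a basis of the second factor *)

Section Parseval.
Context {I : choiceType} {e : I -> K0} (oe : orthonormal_basis e).

Local Notation sl j := (fun x => iota x (e j)).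

Let e_dot j k : dot (e j) (e k) = (j == k)%:R.
Proof. by case: oe => h _; apply: h. Qed.

Lemma dense_slices :
  dense (lin_span [set v | exists j x, v = iota x (e j)]).
Proof.
set S' := [set v | _].
pose P := [set v : T | forall r : R, 0 < r ->
  exists2 w, lin_span S' w & `|v - w| <= r%:C].
have PS : lin_span ((fun x => iota x.1 x.2) @` (setT `*` setT)) `<=` P.
  apply: lin_span_min => [r r0|c v w Pv Pw r r0|_ [[x k] _ <-] r r0] /=.
  - by exists 0; [exact: lin_span0|rewrite subrr normr0 ler0c ltW].
  - have [a [a0 aE]] := ge0_ex_realc (normr_ge0 c).
    have a1 : 0 < a + 1 by rewrite ltr_wpDl.
    have r1 : 0 < r / (a + 1) by rewrite divr_gt0.
    have [v' Sv hv] := Pv _ r1; have [w' Sw hw] := Pw _ r1.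
    exists (c *: v' + w'); first exact: lin_span_linear.
    rewrite opprD addrACA -scalerBr; apply: (le_trans (ler_normD _ _)).
    have a0' : 0 <= a%:C :> R[i] by rewrite ler0c.
    rewrite normrZ aE; apply: (le_trans (lerD (ler_wpM2l a0' hv) hw)).
    rewrite -rmorphM -rmorphD lecR (_ : a * (r / (a + 1)) + r / (a + 1) = r)//.
    by field; rewrite gt_eqF.
  - have [a [a0 aE]] := ge0_ex_realc (normr_ge0 x).
    have a1 : 0 < a + 1 by rewrite ltr_wpDl.
    have r1 : 0 < r / (a + 1) by rewrite divr_gt0.
    case: oe => _ de; have [l Sl kl] := dense_approx k de r1.
    exists (iota x l).
      move: l Sl {kl}; apply: lin_span_min => [|c l l' /= h h'|_ [j _ <-]] /=.
      + have := iotaDr (-1) x 0 0; rewrite scaleN1r addNr scaleN1r addNr => ->.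
        exact: lin_span0.
      + by rewrite iotaDr; apply: lin_span_linear.
      + by apply: lin_span_incl; exists j, x.
    have -> : iota x k - iota x l = iota x (k - l).
      by rewrite addrC -scaleN1r -iotaDr scaleN1r addrC.
    have -> : `|iota x (k - l)| = `|x| * `|k - l|.
      apply/eqP; rewrite -(@eqrXn2 _ 2) ?mulr_ge0//.
      by rewrite exprMn -!dotxx iota_dot.
    have a0' : 0 <= a%:C :> R[i] by rewrite ler0c.
    rewrite aE; apply: (le_trans (ler_wpM2l a0' kl)).
    rewrite -rmorphM lecR mulrA ler_pdivrMr// mulrC.
    by rewrite (ler_wpM2l (ltW r0))// lerDl.
apply: approx_dense => v r r0.
have r2 : 0 < r / 2 by rewrite divr_gt0.
have [w /PS Pw vw] := dense_approx v (tensor_dense tc) r2.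
have [u Su wu] := Pw _ r2; exists u => //.
rewrite -(subrKA w v) -[v - w + _]/(v - w + (w - u)).
apply: (le_trans (ler_normD _ _)); apply: (le_trans (lerD vw wu)).
by rewrite -rmorphD -splitr.
Qed.

(** For a duplicate-free [s], the orthogonal projection onto the sum of the subspaces W ⊗ e_j with j
    in [s]. *)
Let proj (s : seq I) (v : T) : T := \sum_(j <- s) iota (adj (sl j) v) (e j).

Let slice_proj s v j : uniq s -> j \in s ->
  adj (sl j) (v - proj s v) = 0.
Proof.
move=> us js; have bs i := bounded_slice (e i).
apply: dot_ext => x; rewrite dot0r -(dot_adjr _ _ (bs j)) dotBr dot_sumr.
rewrite (bigD1_seq j)//= iota_dot e_dot eqxx mulr1 (dot_adjr x v (bs j)).
rewrite big1 ?addr0 ?subrr//.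
by move=> i ij; rewrite iota_dot e_dot eq_sym (negbTE ij) mulr0.
Qed.

Let proj_orth s v w : uniq s -> dot (v - proj s v) (proj s w) = 0.
Proof.
move=> us; rewrite dot_sumr big_seq big1// => j js.
rewrite dotC (dot_adjr _ _ (bounded_slice (e j))).
by rewrite slice_proj// dot0r rmorph0.
Qed.

Let proj_norm s v : uniq s -> `|v - proj s v| ^+ 2 =
  `|v| ^+ 2 - \sum_(j <- s) `|adj (sl j) v| ^+ 2.
Proof.
move=> us; rewrite -dotxx [LHS]dotBr proj_orth// subr0 dotBl dotxx; congr (_ - _).
rewrite dot_suml; apply: eq_bigr => j _.
by rewrite (dot_adjr _ _ (bounded_slice (e j))) dotxx.
Qed.

Let proj_approx v (r : R) : 0 < r ->
  exists2 s, uniq s & `|v - proj s v| <= r%:C.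
Proof.
move=> r0; have [_ [m [c [w [hw ->]]]] vw] := dense_approx v dense_slices r0.
have [j hj] := choice hw.
pose s := undup [seq j i | i <- enum 'I_m].
have us : uniq s by exact: undup_uniq.
exists s => //; set d := v - proj s v.
have dw : dot d (\sum_i c i *: w i) = 0.
  rewrite dot_sumr big1// => i _; have [x ->] := hj i.
  rewrite dotZr dotC (dot_adjr _ _ (bounded_slice (e (j i)))).
  rewrite slice_proj ?dot0r ?rmorph0 ?mulr0//.
  by rewrite mem_undup map_f// mem_enum.
(* The remainder d is orthogonal to [proj s v] and to the approximant, so |d|^2 = <d, v> = <d, v -
   approximant>. *)
have : `|d| ^+ 2 <= `|d| * r%:C.
  rewrite -[_ ^+ 2]ger0_norm ?exprn_ge0// -dotxx {2}/d dotBr proj_orth// subr0.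
  have -> : dot d v = dot d (v - \sum_i c i *: w i) by rewrite dotBr dw subr0.
  by apply: (le_trans (hilbert_cauchy_schwarz _ _)); rewrite ler_wpM2l.
have [->|nz] := eqVneq (`|d|) 0; first by move=> _; rewrite ler0c ltW.
by rewrite expr2 ler_pM2l// lt_def nz normr_ge0.
Qed.

(** The index set is arbitrary, hence the sum over finite subsets: Bessel's identity bounds each
    finite sum, and a finite projection close to [v] brings some sum close to |v|^2. *)
Lemma parseval (v : T) :
  \esum_(j in [set: I]) (complex.Re (`|adj (sl j) v| ^+ 2))%:E =
  (complex.Re (`|v| ^+ 2))%:E.
Proof.
have Re_sum (s : seq I) : complex.Re (\sum_(j <- s) `|adj (sl j) v| ^+ 2) =
    \sum_(j <- s) complex.Re (`|adj (sl j) v| ^+ 2).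
  exact: raddf_sum.
have bessel s : uniq s -> complex.Re (`|v - proj s v| ^+ 2) =
    complex.Re (`|v| ^+ 2) - \sum_(j <- s) complex.Re (`|adj (sl j) v| ^+ 2).
  by move=> us; rewrite proj_norm// raddfB /= Re_sum.
apply/eqP; rewrite eq_le; apply/andP; split.
  apply: ge_ereal_sup => _ [F [finF _] <-].
  rewrite fsbig_finite// sumEFin lee_fin -subr_ge0 -bessel ?fset_uniq//.
  rewrite -ler0c -ge0_realc exprn_ge0//.
apply/lee_addgt0Pr => d d0.
(* The error in the sum is the square of the distance from [v] to its projection. *)
have [r [r0 rd]] : exists r : R, 0 < r /\ r ^+ 2 <= d.
  exists (Num.sqrt d); rewrite sqrtr_gt0 d0; split=> //.
  by rewrite sqr_sqrtr// ltW.
have [s us hs] := proj_approx v r0.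
have : ((complex.Re (`|v| ^+ 2) - d)%:E <=
    \esum_(j in [set: I]) (complex.Re (`|adj (sl j) v| ^+ 2))%:E)%E.
  apply: esum_ge; exists [set` s]; first by split=> //; exact: finite_seq.
  rewrite -fsbig_seq// sumEFin lee_fin lerBlDr -lerBlDl -bessel//.
  apply: le_trans rd; rewrite -lecR -ge0_realc ?exprn_ge0// rmorphXn /=.
  have r0' : 0 <= r%:C :> R[i] by rewrite ler0c ltW.
  by rewrite ler_sqr ?nnegrE.
by rewrite EFinB leeBlDr.
Qed.

End Parseval.

End HilbertTensor.

(** * The Stinespring space *)

Section Stinespring.
Context {R : realType} {H0 : hilbert R} {N : set (H0 -> H0)} {n : nat}.
Context {t : 'I_n -> H0 -> H0} {H : hilbert R} { pi : (H0 -> H0) -> H -> H}.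
Context (Nf : vn_factor N) (Nt : forall k, N (t k)) (pir : faithful_normal_rep N pi).
Context (H1 : (idfun : H -> H) <> 0).
Implicit Types (a b : H0 -> H0) (c : R[i]).

Local Notation M := (commutant (pi @` N)).
Local Notation Theta := (fun a => \sum_k (t k \o a \o adj (t k))).

Let Nb a : N a -> bounded_op a. Proof. by case: Nf => -[h _ _] _; apply: h. Qed.
Let NA a : N a -> N (adj a). Proof. by case: Nf => -[_ h _] _; apply: h. Qed.

Lemma von_neumann_star (K : hilbert R) (S : set (K -> K)) :
  von_neumann S -> op_star_algebra S.
Proof.
case=> bS aS <-; have [h1 _ _ _ h2] := commutant_star bS aS.
exact: commutant_star.
Qed.

Let Nstar : op_star_algebra N. Proof. by apply: von_neumann_star; case: Nf. Qed.
Let N1 : N idfun. Proof. by case: Nstar. Qed.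
Let NL c a b : N a -> N b -> N (c *: a + b).
Proof. by case: Nstar => _ _ h _ _; apply: h. Qed.
Let NM a b : N a -> N b -> N (a \o b).
Proof. by case: Nstar => _ _ _ h _; apply: h. Qed.
Let piL c a b : N a -> N b -> pi (c *: a + b) = c *: pi a + pi b.
Proof. by case: pir => h _ _ _ _; apply: h. Qed.
Let piM a b : N a -> N b -> pi (a \o b) = pi a \o pi b.
Proof. by case: pir => _ h _ _ _; apply: h. Qed.
Let piA a : N a -> pi (adj a) = adj (pi a).
Proof. by case: pir => _ _ h _ _; apply: h. Qed.
Let pi1 : pi idfun = idfun. Proof. by case: pir. Qed.
Let piI a b : N a -> N b -> pi a = pi b -> a = b.
Proof. by case: pir => _ _ _ _ [h _ _]; apply: h. Qed.
Let piN_vn : von_neumann (pi @` N). Proof. by case: pir => _ _ _ _ []. Qed.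
Let pib a : N a -> bounded_op (pi a).
Proof. by move=> Na; case: piN_vn => h _ _; apply: h; exists a. Qed.

Lemma rep_commutant_star : op_star_algebra M.
Proof.
apply: commutant_star; first by case: piN_vn.
by case: piN_vn.
Qed.

Let Mb x : M x -> bounded_op x. Proof. by case. Qed.

Lemma rep_commute a x : N a -> M x -> pi a \o x = x \o pi a.
Proof. by move=> Na [_ h]; apply: h; exists a. Qed.

Lemma rep_comb m (c : 'I_m -> R[i]) (a : 'I_m -> H0 -> H0) :
  (forall i, N (a i)) -> pi (\sum_i c i *: a i) = \sum_i c i *: pi (a i).
Proof. by move=> Na; have [_ ->] := star_algebra_map_comb Nstar c piL Na. Qed.

Lemma rep_scalar c : pi (c *: idfun) = c *: idfun.
Proof.
have := @rep_comb 1 (fun=> c) (fun=> idfun) (fun=> N1).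
by rewrite !big_ord1 pi1.
Qed.

(** Such an x lies in the bicommutant of pi(N), which is pi(N); its preimage is central in N because
    pi is injective on N, hence scalar. *)
Lemma rep_factor x : M x -> (forall y, M y -> y \o x = x \o y) ->
  exists c, x = c *: idfun.
Proof.
move=> Mx cx; case: piN_vn => _ _ cc.
have [a Na xE] : (pi @` N) x by rewrite -cc; split; [exact: Mb|exact: cx].
have : (N `&` commutant N) a.
  split=> //; split; first exact: Nb.
  move=> b Nb'; apply: piI; [exact: NM|exact: NM|].
  by rewrite (piM Nb' Na) (piM Na Nb') xE; case: Mx => _; apply; exists b.
case: Nf => _ -> [c aE]; exists c; rewrite -xE aE; exact: rep_scalar.
Qed.

(** This is where H has to be nonzero; [trace_nontrivial] obtains that from tau(1) = 1. *)
Lemma scalar_op_inj c d : c *: (idfun : H -> H) = d *: idfun -> c = d.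
Proof.
move=> /eqP; rewrite -subr_eq0 -scalerBl scaler_eq0 subr_eq0.
by case/orP=> [/eqP//|/eqP].
Qed.

(** Each term t_k a1^* a2 t_k^* is the product of the adjoint of a1 t_k^* with a2 t_k^*. *)
Lemma stinespring_formE a1 (h1 : H) a2 h2 : N a1 -> N a2 ->
  stinespring_form Theta pi a1 h1 a2 h2 =
  \sum_k dot (pi (a1 \o adj (t k)) h1) (pi (a2 \o adj (t k)) h2).
Proof.
move=> Na1 Na2; rewrite /stinespring_form.
have Nat a k : N a -> N (a \o adj (t k)) by move=> Na; apply: NM => //; apply: NA.
have e k : t k \o (adj a1 \o a2) \o adj (t k) =
    adj (a1 \o adj (t k)) \o (a2 \o adj (t k)).
  by rewrite (adj_comp (Nb Na1) (Nb (NA (Nt k)))) (adjK (Nb (Nt k))).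
have -> : \sum_k (t k \o (adj a1 \o a2) \o adj (t k)) =
    \sum_k 1 *: (adj (a1 \o adj (t k)) \o (a2 \o adj (t k))).
  by apply: eq_bigr => k _; rewrite scale1r e.
rewrite rep_comb => [|k]; last by apply: NM; [apply: NA|]; apply: Nat.
rewrite fct_sumE dot_sumr; apply: eq_bigr => k _.
rewrite scale1r (piM (NA (Nat _ k Na1)) (Nat _ k Na2)) (piA (Nat _ k Na1)) /=.
by rewrite dot_adjr//; apply: pib; apply: Nat.
Qed.

Lemma stinespring_exists : exists (K : hilbert R) (iota : (H0 -> H0) -> H -> K),
  tensor_completion N (stinespring_form Theta pi) iota.
Proof.
have Nat a k : N a -> N (a \o adj (t k)) by move=> Na; apply: NM => //; apply: NA.
apply: tensor_completion_exists => // [c a b d h k Na Nb' Nd|c a d h h' k Na Nd|m c a h Na].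
- rewrite !stinespring_formE//; last exact: NL.
  rewrite mulr_sumr -big_split; apply: eq_bigr => l _ /=.
  rewrite -dotZr -dotDr; congr (dot _ _).
  have -> : (c *: a + b) \o adj (t l) = c *: (a \o adj (t l)) + (b \o adj (t l)) by [].
  by rewrite piL//; apply: Nat.
- rewrite !stinespring_formE// mulr_sumr -big_split; apply: eq_bigr => l _ /=.
  by rewrite -dotZr -dotDr (bounded_linear (pib (Nat _ _ Na))).
- apply: (components_ge0 (g := fun l (p : (H0 -> H0) * H) => pi (p.1 \o adj (t l)) p.2)
    (k := fun p q => stinespring_form Theta pi p.1 p.2 q.1 q.2) c
    (x := fun i => (a i, h i))).
  by move=> i j; apply: stinespring_formE; exact: Na.
Qed.

Lemma stinespring_components (K : hilbert R) (iota : (H0 -> H0) -> H -> K) :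
  tensor_completion N (stinespring_form Theta pi) iota ->
  exists U : 'I_n -> K -> H, [/\ forall k, bounded_op (U k),
    forall k a h, N a -> U k (iota a h) = pi (a \o adj (t k)) h &
    forall v, \sum_k adj (U k) (U k v) = v].
Proof.
move=> tc; have [_ _ hf _] := tc.
have [|U [bU hU sU]] := isometry_components (n := n)
  (g := fun k (x : (H0 -> H0) * H) => pi (x.1 \o adj (t k)) x.2) (tensor_dense tc).
  by move=> [a h] [b k] [/= Na _] [/= Nb' _]; rewrite hf// stinespring_formE.
by exists U; split=> // k a h Na; apply: (hU k (a, h)).
Qed.

(** * The scalar matrix of the Stinespring components *)

Section Coefficients.
Context {K : hilbert R} {iota : (H0 -> H0) -> H -> K} {U : 'I_n -> K -> H}.
Context (tc : tensor_completion N (stinespring_form Theta pi) iota).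
Context (bU : forall k, bounded_op (U k)).
Context (hU : forall k a h, N a -> U k (iota a h) = pi (a \o adj (t k)) h).
Context (sU : forall v, \sum_k adj (U k) (U k v) = v).

Lemma left_factor_commute a : N a ->
  forall b h k, N b -> pi a (U k (iota b h)) = U k (iota (a \o b) h).
Proof.
move=> Na b h k Nb'; rewrite (hU k h Nb') (hU k h (NM Na Nb')) -compA.
by rewrite (piM Na (NM Nb' (NA (Nt k)))).
Qed.

Lemma right_factor_commute x : M x ->
  forall b h k, N b -> x (U k (iota b h)) = U k (iota b (x h)).
Proof.
move=> Mx b h k Nb'; rewrite (hU k h Nb') (hU k (x h) Nb').
by have /(congr1 (fun F => F h)) := rep_commute (NM Nb' (NA (Nt k))) Mx.
Qed.

Lemma left_tensor_op a : N a ->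
  tensor_op N iota (fun b => a \o b) idfun = compress U (pi a).
Proof.
move=> Na; apply: (tensor_op_compress tc bU sU (pib Na)).
exact: left_factor_commute.
Qed.

Lemma right_tensor_op x : M x -> tensor_op N iota idfun x = compress U x.
Proof.
move=> Mx; apply: (tensor_op_compress tc bU sU (Mb Mx)).
exact: right_factor_commute.
Qed.

Lemma left_intertwine a k : N a -> U k \o compress U (pi a) = pi a \o U k.
Proof.
by move=> Na; apply: (compress_intertwine tc bU sU _ (pib Na) (left_factor_commute Na)).
Qed.

Lemma right_intertwine x k : M x -> U k \o compress U x = x \o U k.
Proof.
by move=> Mx; apply: (compress_intertwine tc bU sU _ (Mb Mx) (right_factor_commute Mx)).
Qed.

Lemma left_intertwine_adj a k : N a ->
  compress U (pi a) \o adj (U k) = adj (U k) \o pi a.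
Proof.
move=> Na; apply: (compress_intertwine_adj bU); first exact: pib.
by rewrite -piA//; apply: left_intertwine; apply: NA.
Qed.

Lemma right_intertwine_adj x k : M x ->
  compress U x \o adj (U k) = adj (U k) \o x.
Proof.
move=> Mx; apply: (compress_intertwine_adj bU); first exact: Mb.
by apply: right_intertwine; case: rep_commutant_star => _ _ _ _; apply.
Qed.

(* [U j U_k^*] lies in the commutants of both [pi N] and [(pi N)'], hence in the
   centre of the factor. *)
Lemma coefficient_exists j k : exists c, U j \o adj (U k) = c *: idfun.
Proof.
have comm S : U j \o compress U S = S \o U j ->
    compress U S \o adj (U k) = adj (U k) \o S ->
    S \o (U j \o adj (U k)) = (U j \o adj (U k)) \o S.
  by move=> h1 h2; rewrite compA -h1 -compA h2.
apply: rep_factor => [|y My].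
  split; first by apply: bounded_comp => //; apply: bounded_adj.
  move=> _ [a Na <-].
  by apply: comm; [exact: left_intertwine|exact: left_intertwine_adj].
by apply: comm; [exact: right_intertwine|exact: right_intertwine_adj].
Qed.

(** C represents V V^* for the isometry V = (U_k)_k. The last two clauses are the hypotheses of
    [idempotent_has_dim]; they also determine the rank independently of the completion. *)
Lemma coefficient_matrix : exists C : 'M[R[i]]_n,
  [/\ forall j k, U j \o adj (U k) = C j k *: idfun, C *m C = C,
    forall j, t j = \sum_k C k j *: t k &
    forall v : 'cV[R[i]]_n, \sum_k v k 0 *: t k = 0 -> C *m v = 0].
Proof.
have h j : exists d : 'I_n -> R[i], forall k, U j \o adj (U k) = d k *: idfun.
  by have [d hd] := choice (coefficient_exists j); exists d.
have [d hd] := choice h.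
pose C : 'M[R[i]]_n := \matrix_(j, k) d j k.
have hC j k : U j \o adj (U k) = C j k *: idfun by rewrite mxE hd.
have CH j k : (C j k)^* = C k j.
  apply: scalar_op_inj; rewrite -hC.
  have := adj_comp (bU j) (bounded_adj (bU k)).
  rewrite (adjK (bU k)) => <-; rewrite hC.
  have := adj_linear (C j k) (@bounded_id _ H) (@boundedP_zero _ H H).
  rewrite addr0 => ->; rewrite adj_id.
  by rewrite adj0 addr0.
(* Taking adjoints, a relation between the t_k gives the conjugate relation between the U_k, as seen
   on elementary tensors. Composing with U_j^* gives the relation for the entries C_kj, and
   conjugating again the row j of C v. *)
have rel (v : 'cV[R[i]]_n) : \sum_k v k 0 *: t k = 0 -> C *m v = 0.
  move=> hv; apply/matrixP => j l; rewrite ord1 !mxE.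
  have s0 : \sum_k (v k 0)^* *: U k = 0.
    have bs : bounded_op (\sum_k (v k 0)^* *: U k).
      by apply: boundedP_sum => k _; apply: boundedP_scale.
    apply: (tensor_ext tc bs (@boundedP_zero _ K H)) => b h' Nb'.
    rewrite fct_sumE.
    have -> : \sum_k ((v k 0)^* *: U k) (iota b h') =
        (\sum_k (v k 0)^* *: pi (b \o adj (t k))) h'.
      by rewrite fct_sumE; apply: eq_bigr => k _; rewrite !fctE hU.
    rewrite -rep_comb => [|k]; last by apply: NM => //; apply: NA.
    have -> : \sum_k (v k 0)^* *: (b \o adj (t k)) = 0 *: idfun.
      rewrite -comp_sumr; last exact: Nb.
      rewrite -(adj_comb Nstar)// hv; apply/funext => x.
      by rewrite adj0 fctE scale0r /=; exact: bounded0 (Nb Nb').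
    by rewrite rep_scalar scale0r.
  have : \sum_k (v k 0)^* *: (U k \o adj (U j)) = 0.
    by rewrite -comp_suml s0.
  under eq_bigr do rewrite hC scalerA.
  rewrite -scaler_suml -(scale0r idfun) => /scalar_op_inj s1.
  have := congr1 Num.conj s1; rewrite rmorph0 rmorph_sum /= => {2}<-.
  by apply: eq_bigr => k _; rewrite rmorphM /= conjCK CH mulrC.
exists C; split=> //.
(* Insert \sum_l U_l^* U_l = 1 between U_j and U_k^*. *)
- apply/matrixP => j k; apply: scalar_op_inj; rewrite -hC !mxE.
  apply/funext => x; rewrite !fctE scaler_suml /=.
  rewrite -[in RHS](sU (adj (U k) x)) bounded_sum//; apply: eq_bigr => l _.
  have e1 := congr1 (fun F => F (U l (adj (U k) x))) (hC j l).
  have e2 := congr1 (fun F => F x) (hC l k).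
  by move: e1 e2; rewrite !fctE /= => -> ->; rewrite scalerA.
(* Since pi(t_j^* ) x = U_j (1 ⊗ x), the same resolution of the identity expands t_j^* along row j
   of C; taking adjoints turns it into column j. *)
- move=> j.
  have : adj (t j) = \sum_k C j k *: adj (t k).
    apply: piI; [exact: NA|by apply: star_algebra_comb => // k; apply: NA|].
    rewrite rep_comb => [|k]; last exact: NA.
    apply/funext => x; rewrite fct_sumE.
    have -> : pi (adj (t j)) x = U j (iota idfun x) by rewrite hU.
    rewrite -(sU (iota idfun x)) bounded_sum//; apply: eq_bigr => k _.
    have := congr1 (fun F => F (U k (iota idfun x))) (hC j k).
    by rewrite !fctE /= => ->; rewrite hU.
  move/(congr1 (@adj R H0 H0)); rewrite adjK; last exact: Nb.
  rewrite (adj_comb Nstar) => [|k]; last exact: NA.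
  move=> ->; apply: eq_bigr => k _; rewrite CH adjK//; exact: Nb.
Qed.

End Coefficients.

End Stinespring.

(** * The index *)

Section Index.
Context {R : realType} {H0 : hilbert R} {N : set (H0 -> H0)} {n : nat}.
Context {t : 'I_n -> H0 -> H0} {H : hilbert R} { pi : (H0 -> H0) -> H -> H}.
Context {tau : (H -> H) -> R[i]}.
Context (Nf : vn_factor N) (Nt : forall k, N (t k)) (pir : faithful_normal_rep N pi).

Local Notation M := (commutant (pi @` N)).
Local Notation Theta := (fun a => \sum_k (t k \o a \o adj (t k))).

Context (Mtau : normalized_trace M tau).

Let Mstar : op_star_algebra M := rep_commutant_star pir.
Let Mb x : M x -> bounded_op x. Proof. by case. Qed.
Let M1 : M idfun. Proof. by case: Mstar. Qed.
Let ML c x y : M x -> M y -> M (c *: x + y).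
Proof. by case: Mstar => _ _ h _ _; apply: h. Qed.
Let MM x y : M x -> M y -> M (x \o y).
Proof. by case: Mstar => _ _ _ h _; apply: h. Qed.
Let MA x : M x -> M (adj x). Proof. by case: Mstar => _ _ _ _; apply. Qed.
Let pib a : N a -> bounded_op (pi a).
Proof. by move=> Na; case: pir => _ _ _ _ [_ _ [h _ _]]; apply: h; exists a. Qed.

Lemma trace_nontrivial : (idfun : H -> H) <> 0.
Proof.
case: Mtau => tL _ _ t1 e.
have := tL (-1) idfun idfun M1 M1.
rewrite scaleN1r addNr mulN1r addNr -e t1 => /eqP.
by rewrite oner_eq0.
Qed.

(** * Coordinates of the Arveson-Stinespring correspondence *)

Section Correspondence.
Context {K : hilbert R} {iota : (H0 -> H0) -> H -> K} {U : 'I_n -> K -> H}.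
Context (tc : tensor_completion N (stinespring_form Theta pi) iota).
Context (bU : forall k, bounded_op (U k)).
Context (hU : forall k a h, N a -> U k (iota a h) = pi (a \o adj (t k)) h).
Context (sU : forall v, \sum_k adj (U k) (U k v) = v).

Let leftE := left_tensor_op Nf Nt pir tc bU hU sU.
Let rightE := right_tensor_op Nf Nt tc bU hU sU.

Local Notation E := (@celem R H (arveson_stinespring N pi iota)).
Local Notation left x := (tensor_op N iota idfun x).

Lemma corrP X : E X <-> bounded_op X /\
  forall a, N a -> X \o pi a = compress U (pi a) \o X.
Proof. by split=> -[bX hX]; split=> // a Na; rewrite hX// leftE. Qed.

Lemma corr_coord X k : E X -> M (U k \o X).
Proof.
move=> /corrP[bX hX]; split=> [|_ [a Na <-]]; first exact: bounded_comp.
apply/funext => h /=; have /= -> := congr1 (@^~ h) (hX a Na).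
by have /= -> := congr1 (@^~ (X h)) (left_intertwine Nf Nt pir tc bU hU sU k Na).
Qed.

Lemma corr_generator k : E (adj (U k)).
Proof.
apply/corrP; split=> [|a Na]; first exact: bounded_adj.
by rewrite (left_intertwine_adj Nf Nt pir tc bU hU sU).
Qed.

Lemma corr_linear c X Y : E X -> E Y -> E (c *: X + Y).
Proof.
move=> /corrP[bX hX] /corrP[bY hY]; apply/corrP; split=> [|a Na].
  by apply: boundedP_add => //; apply: boundedP_scale.
rewrite comp_linearr; last by apply: bounded_compress => //; apply: pib.
by rewrite -hX// -hY.
Qed.

Lemma corr_left x X : M x -> E X -> E (left x \o X).
Proof.
move=> Mx EX; have [bX hX] := (corrP X).1 EX.
have bx := bounded_compress bU (Mb Mx).
apply/corrP; rewrite rightE//; split=> [|a Na]; first exact: bounded_comp.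
have ba := bounded_compress bU (pib Na).
have NM b : N b -> N (a \o b).
  by move=> Nb; case: (von_neumann_star (proj1 Nf)) => _ _ _ h _; apply: h.
(* On elementary tensors the two operators act on different factors. *)
have cc : compress U x \o compress U (pi a) = compress U (pi a) \o compress U x.
  apply: (tensor_ext tc) => [||b h Nb']; try exact: bounded_comp.
  have eL h' b' (Nb'' : N b') := compress_tensor sU h' Nb''
    (left_factor_commute Nf Nt pir hU Na).
  have eR h' b' (Nb'' : N b') := compress_tensor sU h' Nb''
    (right_factor_commute Nf Nt hU Mx).
  by rewrite /= (eL _ _ Nb') (eR _ _ (NM _ Nb')) (eR _ _ Nb') (eL _ _ Nb').
apply/funext => h /=; have /= -> := congr1 (@^~ h) (hX a Na).
by have /= -> := congr1 (@^~ (X h)) cc.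
Qed.

(** The resolution of the identity inserted between X^* and Y expresses the inner product by
    coordinates in M. The factors [1] give the sum the shape of the lemmas on combinations. *)
Lemma corr_inner X Y : E X -> E Y ->
  adj X \o Y = \sum_k 1 *: (adj (U k \o X) \o (U k \o Y)).
Proof.
move=> [bX _] [bY _]; apply/funext => h; apply: dot_ext => z.
rewrite fct_sumE dot_sumr /= -dot_adjr// -[in LHS](sU (Y h)) dot_sumr.
apply: eq_bigr => k _; rewrite scale1r /= -!dot_adjr//; exact: bounded_comp.
Qed.

Lemma corr_inner_mem X Y : E X -> E Y -> M (adj X \o Y).
Proof.
move=> EX EY; rewrite corr_inner//; apply: (star_algebra_comb Mstar) => k.
by apply: MM; [apply: MA|]; apply: corr_coord.
Qed.

(** * The correspondence tensored with the GNS space *)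

Section LeftModule.
Context {L2 : hilbert R} {Lam : (H -> H) -> L2} (gL : gns M tau Lam).

Local Notation lm := (lmult M Lam).
Local Notation Om := (Lam idfun).
Local Notation form := (fun X x Y y => dot x (lm (adj X \o Y) y)).

Let lmb x : M x -> bounded_op (lm x). Proof. exact: (bounded_lmult Mstar Mtau gL). Qed.

Lemma corr_form X x Y y : E X -> E Y ->
  dot x (lm (adj X \o Y) y) = \sum_k dot (lm (U k \o X) x) (lm (U k \o Y) y).
Proof.
move=> EX EY; rewrite corr_inner//.
have Mk k : M (adj (U k \o X) \o (U k \o Y)).
  by apply: MM; [apply: MA|]; apply: corr_coord.
have [_ ->] := star_algebra_map_comb Mstar (F := lm) (fun=> 1)
  (fun c a b Ma Mb => lmult_linear Mstar Mtau gL c Ma Mb) Mk.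
rewrite fct_sumE dot_sumr; apply: eq_bigr => k _.
have MX := corr_coord k EX; have MY := corr_coord k EY.
rewrite scale1r (lmult_comp Mstar Mtau gL (MA MX) MY) /=.
by rewrite -(lmult_adj Mstar Mtau gL MX) -dot_adjr//; apply: lmb.
Qed.

Lemma corr_tensor_exists : exists (P : hilbert R) (iotaP : (H -> K) -> L2 -> P),
  tensor_completion E form iotaP.
Proof.
apply: tensor_completion_exists => [c X Y|c X Y Z x y EX EY EZ|c X Z x y z EX EZ|m c X x EX].
- exact: corr_linear.
- rewrite !corr_form//; last exact: corr_linear.
  rewrite mulr_sumr -big_split; apply: eq_bigr => k _ /=.
  have -> : U k \o (c *: X + Y) = c *: (U k \o X) + (U k \o Y) by rewrite comp_linearr.
  rewrite (lmult_linear Mstar Mtau gL) ?fctE ?dotDr ?dotZr//; exact: corr_coord.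
- by rewrite (bounded_linear (lmb (corr_inner_mem EZ EX))) dotDr dotZr.
- apply: (components_ge0 (g := fun k (p : (H -> K) * L2) => lm (U k \o p.1) p.2)
    (k := fun p q => dot p.2 (lm (adj p.1 \o q.1) q.2)) c (x := fun i => (X i, x i))).
  by move=> i j; apply: corr_form; exact: EX.
Qed.

Section Tensored.
Context {P : hilbert R} {iotaP : (H -> K) -> L2 -> P}.
Context (tcP : tensor_completion E form iotaP).

Lemma corr_components : exists Q : 'I_n -> P -> L2, [/\ forall k, bounded_op (Q k),
    forall k X y, E X -> Q k (iotaP X y) = lm (U k \o X) y &
    forall v, \sum_k adj (Q k) (Q k v) = v].
Proof.
have [_ _ hf _] := tcP.
have [|Q [bQ hQ sQ]] := isometry_components (n := n)
  (g := fun k (p : (H -> K) * L2) => lm (U k \o p.1) p.2) (tensor_dense tcP).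
  by move=> [X x] [Y y] [/= EX _] [/= EY _]; rewrite hf// corr_form.
by exists Q; split=> // k X y EX; apply: (hQ k (X, y)).
Qed.

Context {Q : 'I_n -> P -> L2} (bQ : forall k, bounded_op (Q k)).
Context (hQ : forall k X y, E X -> Q k (iotaP X y) = lm (U k \o X) y).
Context (sQ : forall v, \sum_k adj (Q k) (Q k v) = v).
Context {C : 'M[R[i]]_n} (hC : forall j k, U j \o adj (U k) = C j k *: idfun).

Local Notation sigma x := (tensor_op E iotaP (fun X => left x \o X) idfun).

Let lm_commute x : M x -> forall X y k, E X ->
  lm x (Q k (iotaP X y)) = Q k (iotaP (left x \o X) (idfun y)).
Proof.
move=> Mx X y k EX; rewrite hQ// hQ; last exact: corr_left.
have -> : U k \o (left x \o X) = x \o (U k \o X).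
  rewrite rightE//; apply/funext => h /=.
  by have /= -> := congr1 (@^~ (X h)) (right_intertwine Nf Nt tc bU hU sU k Mx).
by rewrite (lmult_comp Mstar Mtau gL Mx (corr_coord k EX)).
Qed.

Lemma corr_action x : M x -> sigma x = compress Q (lm x).
Proof.
by move=> Mx; apply: (tensor_op_compress tcP bQ sQ (lmb Mx)); apply: lm_commute.
Qed.

Lemma corr_action_intertwine x k : M x -> Q k \o sigma x = lm x \o Q k.
Proof.
move=> Mx; rewrite corr_action//.
exact: (compress_intertwine tcP bQ sQ _ (lmb Mx) (lm_commute Mx)).
Qed.

Lemma corr_action_intertwine_adj x k : M x ->
  sigma x \o adj (Q k) = adj (Q k) \o lm x.
Proof.
move=> Mx; rewrite corr_action//.
apply: (compress_intertwine_adj bQ (lmb Mx)).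
rewrite (lmult_adj Mstar Mtau gL Mx) -corr_action; last exact: MA.
by apply: corr_action_intertwine; apply: MA.
Qed.

(** U_k^* is itself an element of the correspondence and Q_k^* y = U_k^* ⊗ y; applying Q_j gives
    left multiplication by the scalar U_j U_k^*. *)
Lemma corr_coefficient j k : Q j \o adj (Q k) = C j k *: idfun.
Proof.
have e y : adj (Q k) y = iotaP (adj (U k)) y.
  apply: (dense_span_dot_ext (tensor_dense tcP)) => _ [[X z] [/= EX _] <-].
  have [_ _ hf _] := tcP; have EU := corr_generator k.
  rewrite -dot_adjr// hQ// hf//.
  have -> : adj X \o adj (U k) = adj (U k \o X).
    by rewrite adj_comp//; case: EX.
  rewrite -(lmult_adj Mstar Mtau gL (corr_coord k EX)) -dot_adjr//.
  exact/lmb/corr_coord.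
apply/funext => y; rewrite /= e hQ; last exact: corr_generator.
by rewrite hC (lmult_scalar Mstar Mtau gL).
Qed.

(* With [S k j] the operators [e_j^* u Q_k^*] on [L2], [tau (p j j)] is the sum
   over [k] of [|S k j ^* Om|^2 = |S k j Om|^2]; summing over [j] by Parseval
   leaves the sum of [|Q_k^* Om|^2 = C k k]. *)
Lemma corr_module_dim d : is_module_dim M tau Lam (fun x => sigma x) d ->
  d = (complex.Re (\tr C))%:E.
Proof.
move=> [K0 [I [e [T [iotaT [u [p [oe tcT [bu nu hu] hp ->]]]]]]]].
have [_ _ dotT _] := tcT.
have bs j : bounded_op (fun x => iotaT x (e j)) := bounded_slice tcT (e j).
pose S k j := adj (fun x => iotaT x (e j)) \o (u \o adj (Q k)).
have bS k j : bounded_op (S k j).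
  by do 2 (apply: bounded_comp; try exact: bounded_adj).
have cS k j x : M x -> S k j \o lm x = lm x \o S k j.
  move=> Mx; apply/funext => y; rewrite /S /=.
  have /= <- := congr1 (@^~ y) (corr_action_intertwine_adj k Mx).
  have /= -> := congr1 (@^~ (adj (Q k) y)) (hu x Mx).
  by have /= -> := congr1 (@^~ (u (adj (Q k) y))) (slice_intertwine tcT (e j) (lmb Mx)).
(* The diagonal entry is |u^* (Om ⊗ e_j)|^2, which splits along the Q_k into the squares of |S_kj^*
   Om|. *)
have taup j : tau (p j j) = \sum_k `|S k j Om| ^+ 2.
  have [Mp hpj] := hp j j.
  rewrite -(rmult_unit Mstar Mtau gL Mp) -hpj.
  have -> : dot (iotaT Om (e j)) (u (adj u (iotaT Om (e j)))) =
      `|adj u (iotaT Om (e j))| ^+ 2 by rewrite -dotxx dot_adjl.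
  rewrite -(norm_resolution bQ sQ); apply: eq_bigr => k _; congr (_ ^+ 2).
  (* The adjoint must go: only S_kj Om is a component of a vector independent of j, namely u Q_k^*
     Om. *)
  rewrite -(commuting_trace_vector Mstar Mtau gL (bS k j) (cS k j)); congr `|_|.
  rewrite /S (adj_comp (bounded_adj (bs j))) ?(adj_comp bu (bounded_adj (bQ k))).
    by rewrite (adjK (bs j)) (adjK (bQ k)).
  by apply: bounded_comp => //; apply: bounded_adj.
have -> : \esum_(j in [set: I]) (complex.Re (tau (p j j)))%:E =
    \esum_(j in [set: I]) \sum_k (complex.Re (`|S k j Om| ^+ 2))%:E.
  by apply: eq_esum => j _; rewrite taup sumEFin; congr (_%:E); exact: raddf_sum.
rewrite esum_sum; last first.
  by move=> j k _ _; rewrite lee_fin -ler0c -ge0_realc exprn_ge0.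
have -> : complex.Re (\tr C) = \sum_k complex.Re (C k k).
  by rewrite /mxtrace; exact: raddf_sum.
rewrite -sumEFin; apply: eq_bigr => k _.
rewrite (parseval tcT oe); congr (_%:E).
rewrite /= nu -dotxx dot_adjl//.
have /= -> := congr1 (fun F => F Om) (corr_coefficient k k).
by rewrite fctE dotZr (gns_unit_norm Mstar Mtau gL) mulr1.
Qed.

Lemma corr_module_dim_exists : exists d,
  is_module_dim M tau Lam (fun x => sigma x) d.
Proof.
have Om1 := gns_unit_norm Mstar Mtau gL.
(* The Kronecker delta as a kernel yields C^n with its standard basis. It is positive because it is
   a sum of inner products of multiples of the unit vector [Om]. *)
have [|K0 [e [he de]]] := @kernel_hilbert R 'I_n setT (fun i j => (i == j)%:R).
  move=> m c x _.
  apply: (components_ge0 (g := fun l i => (i == l)%:R *: Om)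
    (k := fun i j : 'I_n => (i == j)%:R)) => i j.
  rewrite (bigD1 (x i))//= dotZl dotZr Om1 eqxx conjC1 mul1r mulr1 big1.
    by rewrite addr0 eq_sym.
  by move=> l lx; rewrite dotZl eq_sym (negbTE lx) conjC0 mul0r.
have oe : orthonormal_basis e by split=> [j k|]; [exact: he|].
have [T [iotaT tcT]] := @hilbert_tensor_exists R L2 K0.
have [_ _ dotT _] := tcT.
have bs j : bounded_op (fun x => iotaT x (e j)) := bounded_slice tcT (e j).
pose u : P -> T := \sum_k ((fun x => iotaT x (e k)) \o Q k).
have uE v : u v = \sum_k iotaT (Q k v) (e k) by rewrite /u fct_sumE.
have bu : bounded_op u by apply: boundedP_sum => k _; apply: bounded_comp.
have dotu x j v : dot (iotaT x (e j)) (u v) = dot x (Q j v).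
  rewrite uE dot_sumr (bigD1 j)//= dotT// he// eqxx mulr1 big1 ?addr0// => k kj.
  by rewrite dotT// he// eq_sym (negbTE kj) mulr0.
pose p j k : H -> H := C j k *: idfun + 0.
exists (\esum_(j in [set: 'I_n]) (complex.Re (tau (p j j)))%:E).
exists K0, 'I_n, e, T, iotaT, u, p; split=> //.
- split=> // [x|x Mx].
    apply/eqP; rewrite -(@eqrXn2 _ 2)// -(norm_resolution bQ sQ) -dotxx {1}uE.
    rewrite dot_suml; apply/eqP; apply: eq_bigr => k _.
    by rewrite dotu dotxx.
  have [bL hL] := tensor_op_left tcT (lmb Mx).
  apply/funext => v; rewrite /= !uE bounded_sum//; apply: eq_bigr => k _.
  have /= -> := congr1 (@^~ v) (corr_action_intertwine k Mx).
  by rewrite hL.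
- move=> j k; split; first by apply: ML => //; exact: (star_algebra0 Mstar).
  move=> x y; rewrite dotu.
  have -> : adj u (iotaT y (e k)) = adj (Q k) y.
    by apply: dot_ext => v; rewrite -!dot_adjr// dotC dotu -dotC.
  have /= -> := congr1 (@^~ y) (corr_coefficient j k).
  by rewrite /p addr0 (rmult_scalar Mstar Mtau gL).
Qed.

End Tensored.

End LeftModule.

End Correspondence.

Lemma index_rank : exists C : 'M[R[i]]_n,
  has_dim (lin_span (range t)) (\rank C) /\
  cp_index N Theta pi tau = (\rank C)%:R%:E.
Proof.
(* C is attached to one completion; the relations that fix its rank are recorded with it, so that
   different completions can be compared. *)
have data (K : hilbert R) (iota : (H0 -> H0) -> H -> K) :
    tensor_completion N (stinespring_form Theta pi) iota ->
    exists C : 'M[R[i]]_n, [/\ C *m C = C,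
      forall j, t j = \sum_k C k j *: t k,
      forall v : 'cV[R[i]]_n, \sum_k v k 0 *: t k = 0 -> C *m v = 0,
      forall d, is_left_dim M tau (arveson_stinespring N pi iota) d ->
        d = (\rank C)%:R%:E &
      exists d, is_left_dim M tau (arveson_stinespring N pi iota) d].
  move=> tc; have [U [bU hU sU]] := stinespring_components Nf Nt pir tc.
  have [C [hC CC tC rel]] :=
    coefficient_matrix Nf Nt pir trace_nontrivial tc bU hU sU.
  exists C; split=> //.
    move=> d [L2 [Lam [P [iotaP [gL tcP hd]]]]].
    have [Q [bQ hQ sQ]] := corr_components tc bU hU sU gL tcP.
    rewrite (corr_module_dim tc bU hU sU gL tcP bQ hQ sQ hC hd).
    by rewrite idempotent_trace// -(rmorph_nat (real_complex R)).
  have [L2 [Lam gL]] := gns_exists Mstar Mtau.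
  have [P [iotaP tcP]] := corr_tensor_exists tc bU hU sU gL.
  have [Q [bQ hQ sQ]] := corr_components tc bU hU sU gL tcP.
  have [d hd] := corr_module_dim_exists tc bU hU sU gL tcP bQ hQ sQ hC.
  by exists d, L2, Lam, P, iotaP.
(* The columns of 1 - C are relations between the t_k, so D kills them and D = D C. *)
have rank_le (C D : 'M[R[i]]_n) : (forall j, t j = \sum_k C k j *: t k) ->
    (forall v : 'cV[R[i]]_n, \sum_k v k 0 *: t k = 0 -> D *m v = 0) ->
    (\rank D <= \rank C)%N.
  move=> tC rel; suff -> : D = D *m C by exact: mxrankM_maxr.
  apply/eqP; rewrite -subr_eq0 -{1}[D]mulmx1 -mulmxBr; apply/eqP/matrixP => i j.
  have : D *m col j (1%:M - C) = 0.
    apply: rel; under eq_bigr do rewrite !mxE scalerBl.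
    rewrite sumrB -tC (bigD1 j)//= eqxx scale1r big1 ?addr0 ?subrr// => k kj.
    by rewrite (negbTE kj) scale0r.
  by rewrite colE mulmxA -colE => /matrixP/(_ i 0); rewrite !mxE.
have [K [iota tc]] := stinespring_exists Nf Nt pir.
have [C [CC tC rel uC [d0 hd0]]] := data K iota tc.
exists C; split; first exact: idempotent_has_dim.
(* The default is excluded by the witness [d0]; the chosen value may come from another completion,
   whose matrix has the same rank. *)
rewrite /cp_index; case: xgetP => [d _ [K' [iota' [tc' hd]]]|/(_ d0)[]]; last first.
  by exists K, iota.
have [C' [_ tC' rel' uC' _]] := data K' iota' tc'.
rewrite (uC' _ hd); congr (_%:R%:E); apply/eqP; rewrite eqn_leq.
by rewrite (rank_le C C')// (rank_le C' C).
Qed.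

End Index.

Theorem proposition4p11 (R : realType)
    (H0 : hilbert R) (N : set (H0 -> H0))
    (n : nat) (t : 'I_n -> (H0 -> H0))
    (H : hilbert R) (pi : (H0 -> H0) -> (H -> H)) (tau : (H -> H) -> R[i]) :
  vn_factor N -> semifinite N ->
  (forall k, N (t k)) ->
  op_le (\sum_k (t k \o adj (t k))) idfun ->
  faithful_normal_rep N pi ->
  finite_algebra (commutant (pi @` N)) ->
  normalized_trace (commutant (pi @` N)) tau ->
  exists d : nat,
    [/\ (d <= n)%N,
        has_dim (lin_span (range t)) d &
        cp_index N (fun a => \sum_k (t k \o a \o adj (t k))) pi tau = d%:R%:E].
Proof.
move=> Nf _ Nt _ pir _ Mtau.
have [C [hd ->]] := index_rank Nf Nt pir Mtau.
by exists (\rank C); split=> //; exact: rank_leq_row.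
Qed.
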